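(* Consider the problem $$(\mathrm{CP})\qquad\inf_{\mathbf x\in\mathbb R^n}\{f(\mathbf x): g_i(\mathbf x)\le0,\ i=1,\dots,m\},$$ where $f=s_0+p_0$ and $g_i=s_i+p_i$ ($i=1,\dots,m$) are convex polynomials such that, for each $i=0,1,\dots,m$, $s_i(\mathbf x)=\sum_{j=1}^n u_i^j(x_j)$ with each $u_i^j$ a convex univariate polynomial in $x_j$ of degree at most $2d_j$, and $p_i$ is an SOS-convex polynomial of degree at most $2r$. Let $d_0:=\max_{1\le j\le n}d_j$ and assume $d_0>r$ and that $f$ is bounded from below on the feasible set $\mathbf F=\{\mathbf x: g_i(\mathbf x)\le0,\ i=1,\dots,m\}$. Assume there exists $\widehat{\mathbf x}\in\mathbf F$ with $g_i(\widehat{\mathbf x})<0$ for all $i=1,\dots,m$. Then, with the problems $(\mathrm D^{\mathrm{SPLD}}_{\mathrm{sos}})$ and $(\widetilde{\mathrm D}^{\mathrm{SPLD}}_{\mathrm{sos}})$ defined in the context, $$\mathrm{val}(\mathrm{CP})=\mathrm{val}(\mathrm D^{\mathrm{SPLD}}_{\mathrm{sos}})=\mathrm{val}(\widetilde{\mathrm D}^{\mathrm{SPLD}}_{\mathrm{sos}}),$$ and $(\mathrm D^{\mathrm{SPLD}}_{\mathrm{sos}})$ has an optimal solution.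
   Context: A polynomial is SOS-convex if its Hessian is an SOS matrix polynomial, i.e., $\nabla^2 p(\mathbf x)=F(\mathbf x)^TF(\mathbf x)$ for some matrix polynomial $F$. $\Sigma[\mathbf x]_r$: sums of squares of polynomials in $\mathbf x$ of degree $\le 2r$; $\Sigma[x_j]_{d}$: SOS univariate polynomials in $x_j$ of degree $\le 2d$. $\mathbb N^n_d=\{\boldsymbol\alpha\in\mathbb N^n:|\boldsymbol\alpha|\le d\}$; $\lceil\mathbf x\rceil_r=(\mathbf x^{\boldsymbol\alpha})_{\boldsymbol\alpha\in\mathbb N^n_r}$, of length $s(n,r)=\binom{n+r}{r}$; $\lceil x_j\rceil_{d}=(1,x_j,\dots,x_j^{d})^T$; $(M)_{\boldsymbol\alpha}$ is the coefficient matrix of $\mathbf x^{\boldsymbol\alpha}$ in a polynomial matrix $M$, and $h_{\boldsymbol\alpha}$ the coefficient of $\mathbf x^{\boldsymbol\alpha}$ in a polynomial $h$. $(\mathrm D^{\mathrm{SPLD}}_{\mathrm{sos}})$: maximize $\mu$ over $\mu\in\mathbb R$, $\lambda_i\ge0$ ($i=1,\dots,m$), $\sigma\in\Sigma[\mathbf x]_r$, $\sigma_j\in\Sigma[x_j]_{d_j}$ ($j=1,\dots,n$), subject to the polynomial identity $f+\sum_{i=1}^m\lambda_ig_i-\mu=\sigma+\sum_{j=1}^n\sigma_j$. $(\widetilde{\mathrm D}^{\mathrm{SPLD}}_{\mathrm{sos}})$: minimize $\sum_{\boldsymbol\alpha\in\mathbb N^n_{2d_0}}f_{\boldsymbol\alpha}y_{\boldsymbol\alpha}$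 over $\mathbf y=(y_{\boldsymbol\alpha})_{\boldsymbol\alpha\in\mathbb N^n_{2d_0}}\in\mathbb R^{s(n,2d_0)}$ subject to $\sum_{\boldsymbol\alpha\in\mathbb N^n_{2d_0}}(g_i)_{\boldsymbol\alpha}y_{\boldsymbol\alpha}\le0$, $i=1,\dots,m$; $\sum_{\boldsymbol\alpha\in\mathbb N^n_{2d_0}}y_{\boldsymbol\alpha}(\lceil x_j\rceil_{d_j}\lceil x_j\rceil_{d_j}^T)_{\boldsymbol\alpha}\succeq0$, $j=1,\dots,n$; $\sum_{\boldsymbol\alpha\in\mathbb N^n_{2d_0}}y_{\boldsymbol\alpha}(\lceil\mathbf x\rceil_r\lceil\mathbf x\rceil_r^T)_{\boldsymbol\alpha}\succeq0$; $y_{\mathbf 0}=1$. *)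

(* Defs.v *)
From HB Require Import structures.
From mathcomp Require Import all_boot all_order all_algebra.
From mathcomp Require Import reals.
From mathcomp Require Import mpoly.

Set Implicit Arguments.
Unset Strict Implicit.
Unset Printing Implicit Defensive.

Import Order.TTheory GRing.Theory Num.Theory.
Local Open Scope ring_scope.

Section Defs.
Context (R : realType) (n : nat).

(* total degree of p is at most k (msize p = 1 + degree, 0 for p = 0) *)
Definition mdeg_le (p : {mpoly R[n]}) (k : nat) : Prop := (msize p <= k.+1)%N.

Definition univ_emb (j : 'I_n) (q : {poly R}) : {mpoly R[n]} :=
  \sum_(k < size q) q`_k *: 'X_j ^+ k.

Definition sep_poly (u : 'I_n -> {poly R}) : {mpoly R[n]} :=
  \sum_(j < n) univ_emb j (u j).

Definition convex_fun (phi : ('I_n -> R) -> R) : Prop :=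
  forall (x y : 'I_n -> R) (t : R), 0 <= t -> t <= 1 ->
    phi (fun k => t * x k + (1 - t) * y k) <= t * phi x + (1 - t) * phi y.

Definition convex_upoly (q : {poly R}) : Prop :=
  forall (x y t : R), 0 <= t -> t <= 1 ->
    q.[t * x + (1 - t) * y] <= t * q.[x] + (1 - t) * q.[y].

Definition hessian (p : {mpoly R[n]}) : 'M[{mpoly R[n]}]_n :=
  \matrix_(i < n, j < n) mderiv i (mderiv j p).

Definition sos_convex (p : {mpoly R[n]}) : Prop :=
  exists (k : nat) (F : 'M[{mpoly R[n]}]_(k, n)), hessian p = F^T *m F.

Definition sos_mpoly (r : nat) (s : {mpoly R[n]}) : Prop :=
  exists (k : nat) (q : 'I_k -> {mpoly R[n]}),
    (forall i, mdeg_le (q i) r) /\ s = \sum_(i < k) q i ^+ 2.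

Definition sos_upoly (d : nat) (s : {poly R}) : Prop :=
  exists (k : nat) (q : 'I_k -> {poly R}),
    (forall i, (size (q i) <= d.+1)%N) /\ s = \sum_(i < k) q i ^+ 2.

Definition Lfun (D : nat) (y : 'X_{1..n < D} -> R) (h : {mpoly R[n]}) : R :=
  \sum_(a : 'X_{1..n < D}) h@_(bmnm a) * y a.

(* sum_alpha y_alpha (v v^T)_alpha  for a vector v of polynomials *)
Definition moment_mx (D : nat) (y : 'X_{1..n < D} -> R) (k : nat)
    (v : 'I_k -> {mpoly R[n]}) : 'M[R]_k :=
  \matrix_(a < k, b < k) Lfun y (v a * v b).

Definition mono_vec (r : nat) : 'I_#|{: 'X_{1..n < r.+1}}| -> {mpoly R[n]} :=
  fun i => 'X_[bmnm (enum_val i)].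

Definition var_pow_vec (j : 'I_n) (d : nat) : 'I_d.+1 -> {mpoly R[n]} :=
  fun a => 'X_j ^+ a.

End Defs.

Definition psd (R : realType) (k : nat) (A : 'M[R]_k) : Prop :=
  A^T = A /\ forall v : 'cV[R]_k, 0 <= (v^T *m A *m v) 0 0.

Definition is_inf (R : realType) (S : R -> Prop) (v : R) : Prop :=
  (forall z, S z -> v <= z) /\ (forall e, 0 < e -> exists z, S z /\ z < v + e).
Definition is_sup (R : realType) (S : R -> Prop) (v : R) : Prop :=
  (forall z, S z -> z <= v) /\ (forall e, 0 < e -> exists z, S z /\ v - e < z).

Section Problems.
Context (R : realType) (n m r : nat) (d : 'I_n -> nat)
        (f : {mpoly R[n]}) (g : 'I_m -> {mpoly R[n]}).

Definition d0 : nat := \max_(j < n) d j.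

Definition CP_feasible (x : 'I_n -> R) : Prop := forall i, (g i).@[x] <= 0.

Definition CP_values (z : R) : Prop :=
  exists x, CP_feasible x /\ z = f.@[x].

(* mu is the objective value of a feasible point of (D^SPLD_sos) *)
Definition D_feasible (mu : R) : Prop :=
  exists (lam : 'I_m -> R) (sigma : {mpoly R[n]}) (sig : 'I_n -> {poly R}),
    [/\ forall i, 0 <= lam i,
        sos_mpoly r sigma,
        forall j, sos_upoly (d j) (sig j) &
        f + \sum_(i < m) lam i *: g i - mpolyC n mu
          = sigma + \sum_(j < n) univ_emb j (sig j)].

(* objective values of feasible points of (tilde D^SPLD_sos);
   y is indexed by N^n_{2 d0} = monomials of degree < 2 d0 + 1 *)
Definition Dt_values (z : R) : Prop :=
  exists y : 'X_{1..n < (2 * d0).+1} -> R,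
    [/\ forall i, Lfun y (g i) <= 0,
        forall j, psd (moment_mx y (@var_pow_vec R n j (d j))),
        psd (moment_mx y (@mono_vec R n r)),
        y bm0 = 1 &
        z = Lfun y f].

End Problems.

(* Main.v *)
Require Import Defs.
From HB Require Import structures.
From mathcomp Require Import all_boot all_order all_algebra.
From mathcomp Require Import reals.
From mathcomp Require Import ring lra.
From mathcomp Require polyrcf.
From mathcomp Require boolp classical_sets filter topology normedtype derive.

(** Under Slater's condition, eliminating the constraints one at a time gives
    multipliers [lam] for which the Lagrangian [L = f + sum lam_i g_i - v] is
    nonnegative, where [v] is the value of (CP). A convex polynomial that is
    bounded below attains its minimum, say at [a]. Expanding at [a], the
    SOS-convex part of [L] equals an affine function plus a sum of squares of
    degree at most [2 r]: the quadratic form of its Hessian is a sum of squares,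
    and integrating it along segments from [a] preserves this. Vanishing of the
    gradient at [a] lets the linear terms be absorbed by the univariate parts,
    which become nonnegative, hence sums of squares. So [v] is feasible for the
    SOS dual. The moments of a feasible point of (CP) are feasible for the moment
    problem, whose values in turn dominate those of the SOS dual. *)

Set Implicit Arguments.
Unset Strict Implicit.
Unset Printing Implicit Defensive.

Import Order.TTheory GRing.Theory Num.Theory.
Local Open Scope ring_scope.

(** * Continuity, compactness and infima over the reals *)

Module Compactness.
Import boolp classical_sets filter topology normedtype derive.
Import numFieldNormedType.Exports.
Local Open Scope classical_set_scope.
Local Open Scope ring_scope.

Section Compactness.
Context (R : realType).

(** A name for continuity that stays usable outside this module, where the topological notations are
    not imported. *)
Definition cont n (phi : 'rV[R]_n -> R) : Prop := continuous phi.

Lemma cont_cst n (c : R) : cont (fun _ : 'rV[R]_n => c).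
Proof. by move=> x; exact: cst_continuous. Qed.

Lemma cont_coord n (i : 'I_n) : cont (fun x : 'rV[R]_n => x 0 i).
Proof. exact: coord_continuous. Qed.

Lemma contD n (f g : 'rV[R]_n -> R) :
  cont f -> cont g -> cont (fun x => f x + g x).
Proof. by move=> cf cg x; exact: (continuousD (cf x) (cg x)). Qed.

Lemma contM n (f g : 'rV[R]_n -> R) :
  cont f -> cont g -> cont (fun x => f x * g x).
Proof. by move=> cf cg x; exact: (continuousM (cf x) (cg x)). Qed.

Lemma cont_norm n (f : 'rV[R]_n -> R) : cont f -> cont (fun x => `|f x|).
Proof. by move=> cf x; exact: (cvg_norm (cf x)). Qed.

Lemma cont_sum n (I : finType) (f : I -> 'rV[R]_n -> R) :
  (forall i, cont (f i)) -> cont (fun x => \sum_i f i x).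
Proof.
move=> cf; rewrite /index_enum; elim: (Finite.enum I) => [|i s IHs].
  by under boolp.eq_fun do rewrite big_nil; exact: cont_cst.
by under boolp.eq_fun do rewrite big_cons; exact: contD.
Qed.

(** The box of radius [B] is compact, so the sequence has a cluster point [l]. A closed set
    containing a tail of the sequence contains [l], and sublevel sets of continuous functions are
    closed. One [l] serves all [psi]. *)
Lemma bounded_seq_cluster n (x : nat -> 'rV[R]_n) (B : R) :
  (forall k i, `|x k 0 i| <= B) ->
  exists l : 'rV[R]_n, forall psi, cont psi ->
    (exists N, forall k, (N <= k)%N -> psi (x k) <= 0) -> psi l <= 0.
Proof.
move=> xB.
pose K := [set v : 'rV[R]_n | forall i, `[- B, B]%classic (v ord0 i)].
have cK : compact K.
  exact: (rV_compact (fun _ : 'I_n => @segment_compact R (- B) B)).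
have [l [_ cl]] : K `&` cluster (x @ \oo) !=set0.
  apply: cK; exists 0%N => // k _ i /=; rewrite in_itv /=.
  by have := xB k i; rewrite ler_norml.
exists l => psi cpsi [N xN].
have cA : closed [set v | psi v <= 0].
  exact: (@closed_comp _ _ psi [set t | t <= 0] (fun v _ => cpsi v) (@closed_le R 0)).
have : closure [set v | psi v <= 0] l.
  move: cl; rewrite clusterE; apply.
  by exists N => // k /= Nk; apply: xN.
by rewrite -(closure_id _).1.
Qed.

Lemma poly_min_segment (p : {poly R}) (a b : R) : a <= b ->
  exists c : R, forall t, a <= t <= b -> p.[c] <= p.[t].
Proof.
move=> ab.
have [|c _ cmin] := @EVT_min R (horner p) a b ab.
  by apply: continuous_subspaceT => x; exact: continuous_horner.
by exists c => t tab; apply: cmin; rewrite in_itv.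
Qed.

Lemma glb_approx (T : Type) (P : T -> Prop) (phi : T -> R) (c0 : R) (x0 : T) :
  P x0 -> (forall x, P x -> c0 <= phi x) ->
  exists c, (forall x, P x -> c <= phi x) /\
            (forall e, 0 < e -> exists x, P x /\ phi x < c + e).
Proof.
move=> Px0 Pc0.
have hi : has_inf [set phi x | x in P].
  split; first by exists (phi x0); exists x0.
  by exists c0 => _ [x Px <-]; exact: Pc0.
exists (inf [set phi x | x in P]); split.
  by move=> x Px; apply: (inf_lbound hi.2); exists x.
move=> e e0; have [_ [x Px <-] lt] := inf_adherent e0 hi.
by exists x.
Qed.

End Compactness.
End Compactness.
Import Compactness.
Import polyrcf.

(** * Attainment of the minimum by convex functions that are polynomial on lines *)

Section ConvexMin.
Context (R : realType).

(** A nonconstant polynomial is unbounded at plus infinity, on the side given by the sign of its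
    leading coefficient; comparing [p] and [- p] leaves only constants. *)
Lemma poly_bounded_const (p : {poly R}) (A B : R) :
  (forall t, 0 <= t -> A <= p.[t] <= B) -> forall t, p.[t] = p.[0].
Proof.
move=> pAB t.
have unb (q : {poly R}) (C : R) : (forall t, 0 <= t -> q.[t] <= C) ->
    (1 < size q)%N -> lead_coef q <= 0.
  move=> qC sq; rewrite leNgt; apply/negP => lq.
  have [z zP] := poly_lim_infty (C + 1) lq sq.
  have := zP (Num.max 0 z); have := qC (Num.max 0 z).
  rewrite !le_max !lexx !orbT => /(_ isT) h1 /(_ isT) h2; lra.
have [sp|sp] := leqP (size p) 1%N; first by rewrite (size1_polyC sp) !hornerC.
have l1 : lead_coef p <= 0 by apply: (unb _ B) => // s /pAB/andP[].
have l2 : lead_coef (- p) <= 0.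
  apply: (unb _ (- A)); last by rewrite size_polyN.
  by move=> s /pAB/andP[? _]; rewrite hornerN lerN2.
rewrite lead_coefN oppr_le0 in l2.
have : lead_coef p == 0 by rewrite eq_le l1.
by rewrite lead_coef_eq0 => /eqP p0; rewrite p0 size_poly0 in sp.
Qed.

Variables (n : nat) (phi : 'rV[R]_n -> R).
(** The factor [t] is built in because limits are taken both of [phi] itself and of [phi] at
    rescaled directions. *)
Hypothesis phi_cont : forall t, cont (fun x => phi (t *: x)).
Hypothesis phi_convex : forall (x y : 'rV[R]_n) (t : R), 0 <= t -> t <= 1 ->
  phi (t *: x + (1 - t) *: y) <= t * phi x + (1 - t) * phi y.
Hypothesis phi_line : forall x d : 'rV[R]_n,
  exists p : {poly R}, forall t, phi (x + t *: d) = p.[t].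
Variable c0 : R.
Hypothesis phi_ge : forall x, c0 <= phi x.

Let N (x : 'rV[R]_n) : R := \sum_i `|x 0 i|.

Let N_ge (x : 'rV[R]_n) i : `|x 0 i| <= N x.
Proof. by rewrite /N (bigD1 i) //= lerDl sumr_ge0. Qed.

Let NZ t (x : 'rV[R]_n) : N (t *: x) = `|t| * N x.
Proof. by rewrite /N mulr_sumr; apply: eq_bigr => i _; rewrite mxE normrM. Qed.

(** The point [x + s *: d] is the midpoint of [2 *: x] and [(2 * s) *: d], so convexity bounds [phi]
    from above along the half-line; being also bounded below, the polynomial on that line is
    constant. *)
Lemma invariant_direction (d : 'rV[R]_n) (M : R) :
  (forall t, 0 <= t -> phi (t *: d) <= M) -> forall x t, phi (x + t *: d) = phi x.
Proof.
move=> dM x t; have [p pE] := phi_line x d.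
have -> : phi x = p.[0] by rewrite -pE scale0r addr0.
rewrite pE; apply: (@poly_bounded_const p c0 (2^-1 * phi (2 *: x) + (1 - 2^-1) * M)).
move=> s s0; rewrite -pE phi_ge /=.
have -> : x + s *: d = 2^-1 *: (2 *: x) + (1 - 2^-1) *: ((2 * s) *: d).
  have h : 1 - 2^-1 = 2^-1 :> R by field.
  by rewrite h !scalerA mulKf ?pnatr_eq0 // mulVf ?pnatr_eq0 // scale1r.
apply: le_trans (phi_convex _ _ _ _) _; [lra|lra|].
by rewrite lerD2l ler_wpM2l ?dM; lra.
Qed.

(* Either a minimizing sequence is bounded, or its directions accumulate at
   a recession direction [d]; along [d] the polynomial is constant, so one
   more coordinate in the support of [d] may be set to zero. *)
Lemma convex_min_coord k (S : {set 'I_n}) : #|~: S| = k ->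
  exists x0 : 'rV[R]_n, (forall i, i \in S -> x0 0 i = 0) /\
    forall x : 'rV[R]_n, (forall i, i \in S -> x 0 i = 0) -> phi x0 <= phi x.
Proof.
elim: k S => [|k IHk] S cS.
  exists 0; split=> [i _|x xS]; first by rewrite mxE.
  have -> // : x = 0.
  apply/rowP=> i; rewrite mxE; apply: xS.
  by move/eqP: cS; rewrite cards_eq0 => /eqP/setP/(_ i); rewrite !inE => /negbFE.
pose VS (x : 'rV[R]_n) := forall i, i \in S -> x 0 i = 0.
have VS0 : VS 0 by move=> i _; rewrite mxE.
have [c [cle capp]] := glb_approx VS0 (fun x _ => phi_ge x).
have /boolp.choice[x xP] (j : nat) : exists x, VS x /\ phi x < c + j.+1%:R^-1.
  by apply: capp; rewrite invr_gt0 ltr0n.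
(* The conditions [v 0 i <= 0] and [- v 0 i <= 0] are both closed, so the coordinate subspace passes
   to cluster points. *)
have coord_cl (y : nat -> 'rV[R]_n) l : (forall k, VS (y k)) ->
  (forall psi, cont psi ->
    (exists N, forall k, (N <= k)%N -> psi (y k) <= 0) -> psi l <= 0) -> VS l.
  move=> yS lP i iS; apply/eqP; rewrite eq_le; apply/andP; split.
    by apply: (lP (fun v => v 0 i)); [exact: cont_coord | exists 0%N => j _; rewrite yS].
  rewrite -oppr_le0 -mulN1r; apply: (lP (fun v => -1 * v 0 i)).
    by apply: contM; [exact: cont_cst | exact: cont_coord].
  by exists 0%N => j _; rewrite yS // mulr0.
(* If the minimizing sequence is bounded, its cluster point attains the infimum [c]. *)
have [[B xB]|unb] := boolp.EM (exists B, forall k i, `|x k 0 i| <= B).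
  have [l lP] := bounded_seq_cluster xB.
  exists l; split; first by apply: coord_cl lP => j; case: (xP j).
  move=> z zS; apply: le_trans (cle z zS); apply/ler_addgt0Pr => e e0.
  have [j je] : exists j : nat, j.+1%:R^-1 < e.
    exists (Num.bound e^-1).
    rewrite -[ltRHS]invrK ltf_pV2 ?posrE ?invr_gt0 ?ltr0n //.
    apply: lt_le_trans (archi_boundP _) _; first by rewrite invr_ge0 ltW.
    by rewrite ler_nat.
  have : phi (1 *: l) + - (c + j.+1%:R^-1) <= 0.
    apply: (lP (fun v => phi (1 *: v) + - (c + j.+1%:R^-1))).
      by apply: contD; [exact: phi_cont | exact: cont_cst].
    exists j => k' jk'; rewrite scale1r subr_le0 ltW //.
    apply: lt_le_trans (xP k').2 _; rewrite lerD2l lef_pV2 ?posrE ?ltr0n //.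
    by rewrite ler_nat.
  by rewrite scale1r subr_le0 => /le_trans; apply; rewrite lerD2l ltW.
have far (j : nat) : exists y, [/\ VS y, phi y <= c + 1 & j.+1%:R <= N y].
  apply: boolp.contrapT => noy; apply: unb; exists j.+1%:R => k' i.
  rewrite leNgt; apply/negP => ji; apply: noy; exists (x k'); split.
  - by case: (xP k').
  - apply: ltW; apply: lt_le_trans (xP k').2 _.
    by rewrite lerD2l invf_le1 ?ltr0n // ler1n.
  - exact: le_trans (ltW ji) (N_ge _ _).
have [y yP] := boolp.choice far.
have Ny j : 0 < N (y j) by case: (yP j) => _ _; apply: lt_le_trans; rewrite ltr0n.
pose d j := (N (y j))^-1 *: y j.
have Nd j : N (d j) = 1.
  by rewrite NZ ger0_norm ?invr_ge0 ?(ltW (Ny j)) // mulVf // gt_eqF.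
have dS j : VS (d j).
  by move=> i iS; rewrite mxE; case: (yP j) => /(_ i iS) -> _ _; rewrite mulr0.
have d_bound j i : `|d j 0 i| <= 1 by rewrite -(Nd j) N_ge.
have [l lP] := bounded_seq_cluster d_bound.
pose M := `|phi 0| + `|c + 1|.
(* For large [j], [t *: d j] lies on the segment from 0 to [y j], so convexity bounds [phi] there by
   a constant independent of [t] and [j]; the bound passes to [l]. *)
have lM t : 0 <= t -> phi (t *: l) <= M.
  move=> t0; rewrite -subr_le0.
  apply: (lP (fun v => phi (t *: v) + - M)).
    by apply: contD; [exact: phi_cont | exact: cont_cst].
  exists (Num.bound t) => j tj; rewrite subr_le0.
  have tN : t <= N (y j).
    case: (yP j) => _ _; apply: le_trans; apply: ltW.
    by apply: lt_le_trans (archi_boundP t0) _; rewrite ler_nat ltnW.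
  have -> : t *: d j = (t / N (y j)) *: y j + (1 - t / N (y j)) *: 0.
    by rewrite scaler0 addr0 scalerA.
  have s0 : 0 <= t / N (y j) by rewrite divr_ge0 // ltW.
  have s1 : t / N (y j) <= 1 by rewrite ler_pdivrMr // mul1r.
  apply: le_trans (phi_convex _ _ s0 s1) _; rewrite /M addrC.
  apply: lerD.
    apply: le_trans (ler_norm _) _; rewrite normrM ger0_norm ?subr_ge0 //.
    by rewrite ler_piMl // gerBl.
  case: (yP j) => _ yc _.
  apply: (@le_trans _ _ (t / N (y j) * (c + 1))); first by rewrite ler_wpM2l.
  apply: le_trans (ler_norm _) _; rewrite normrM (ger0_norm s0).
  by rewrite ler_piMl.
have lS : VS l by apply: coord_cl lP.
have linv := invariant_direction lM.
(* All [d j] have norm 1, and so [l] cannot vanish. *)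
have [i li] : exists i, l 0 i != 0.
  apply: boolp.contrapT => l0.
  have : 1 + -1 * N l <= 0.
    apply: (lP (fun v => 1 + -1 * N v)); last first.
      by exists 0%N => j _; rewrite Nd mulN1r subrr.
    apply: contD; first exact: cont_cst.
    apply: contM; first exact: cont_cst.
    by apply: cont_sum => i; apply: cont_norm; exact: cont_coord.
  have -> : N l = 0.
    rewrite /N big1 // => i _; apply/eqP; rewrite normr_eq0.
    by apply/negP => /negP h; apply: l0; exists i.
  by rewrite mulr0 addr0 ler10.
have iS : i \notin S by apply: contra_neqN li => /lS.
have [|x0 [x0S x0min]] := IHk (i |: S).
  move: cS; rewrite (cardsD1 i) inE iS add1n => -[<-].
  by apply: eq_card => j; rewrite !inE negb_or.
exists x0; split; first by move=> j jS; apply: x0S; rewrite inE jS orbT.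
(* Sliding [z] along [l] until its coordinate [i] is zero leaves [phi] unchanged. *)
move=> z zS; rewrite -(linv z (- (z 0 i / l 0 i))); apply: x0min => j.
rewrite !inE !mxE => /orP[/eqP->|jS]; first by rewrite mulNr divfK // subrr.
by rewrite (zS j jS) (lS j jS) mulr0 addr0.
Qed.

Lemma convex_polyline_min : exists x0, forall x, phi x0 <= phi x.
Proof.
have [x0 [_ x0min]] := @convex_min_coord _ set0 erefl.
by exists x0 => x; apply: x0min => i; rewrite inE.
Qed.

End ConvexMin.

(** * Nonnegative univariate polynomials are sums of squares *)

Section UnivariateSOS.
Context (R : realType).

Lemma lead_coef_gt0_nonneg (q : {poly R}) :
  (forall t, 0 <= q.[t]) -> (1 < size q)%N -> 0 < lead_coef q.
Proof.
move=> q0 sq; rewrite ltNge; apply/negP; rewrite le_eqVlt => /orP[|lq].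
  by rewrite lead_coef_eq0 => /eqP q_eq0; rewrite q_eq0 size_poly0 in sq.
have [||z zP] := @poly_lim_infty R (- q) 1.
- by rewrite lead_coefN oppr_gt0.
- by rewrite size_polyN.
by have := zP z (lexx z); have := q0 z; rewrite hornerN; lra.
Qed.

(** A nonconstant nonnegative [q] grows at both ends, the left end being reached by composing with
    [- 'X]. Outside a large segment it exceeds [q.[0]], so its minimum on the segment is global. *)
Lemma poly_nonneg_min (q : {poly R}) :
  (forall t, 0 <= q.[t]) -> exists c, forall t, q.[c] <= q.[t].
Proof.
move=> q0; have [sq|sq] := leqP (size q) 1%N.
  by exists 0 => t; rewrite (size1_polyC sq) !hornerC.
have sX : size (- 'X : {poly R}) = 2 by rewrite size_polyN size_polyX.
have [z1 z1P] := poly_lim_infty q.[0] (lead_coef_gt0_nonneg q0 sq) sq.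
have [||z2 z2P] := @poly_lim_infty R (q \Po - 'X) q.[0].
- apply: lead_coef_gt0_nonneg => [t|]; first by rewrite horner_comp.
  by rewrite size_comp_poly2.
- by rewrite size_comp_poly2.
pose B := Num.max 0 (Num.max z1 z2).
have [B0 B1 B2] : [/\ 0 <= B, z1 <= B & z2 <= B].
  by rewrite /B !le_max !lexx !orbT.
have [|c cmin] := @poly_min_segment R q (- B) B; first lra.
exists c => t.
have c0 : q.[c] <= q.[0] by apply: cmin; lra.
have [tB|Bt] := leP t B; last by apply: le_trans c0 (z1P _ _); lra.
have [Bt|tB'] := leP (- B) t; first by apply: cmin; lra.
apply: le_trans c0 _; have := z2P (- t); rewrite horner_comp !hornerE opprK.
by apply; lra.
Qed.

(** By continuity a negative value at [a] would persist nearby. This recovers the sign at a point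
    where a factor that was divided out vanishes. *)
Lemma poly_ge0_adherent (h : {poly R}) (a : R) :
  (forall e, 0 < e -> exists t, `|t - a| < e /\ 0 <= h.[t]) -> 0 <= h.[a].
Proof.
move=> ha; rewrite leNgt; apply/negP => ha0.
have [|d d0 dP] := @poly_cont R a h (- h.[a]); first by rewrite oppr_gt0.
have [t [/dP ht t0]] := ha d d0.
by move: ht; rewrite ltr_norml => /andP[_]; lra.
Qed.

Lemma sos_upolyDsqr d (s q : {poly R}) :
  sos_upoly d s -> (size q <= d.+1)%N -> sos_upoly d (q ^+ 2 + s).
Proof.
move=> [k [qs [sqs ->]]] sq.
exists k.+1, (fun i => if unlift ord0 i is Some j then qs j else q); split.
  by move=> i; case: unliftP.
by rewrite big_ord_recl unlift_none; under [in RHS]eq_bigr do rewrite liftK.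
Qed.

Lemma size_polyC_sqrt (c : R) d : (size (Num.sqrt c)%:P <= d.+1)%N.
Proof. by rewrite (leq_trans (size_polyC_leq1 _)). Qed.

(* Subtracting its minimum gives the polynomial a root, necessarily double. *)
Lemma poly_nonneg_sos d (q : {poly R}) :
  (forall t, 0 <= q.[t]) -> (size q <= (2 * d).+1)%N -> sos_upoly d q.
Proof.
elim: d q => [|d IHd] q q0 sq.
  have -> : q = (Num.sqrt q`_0)%:P ^+ 2 + 0.
    rewrite addr0 -polyC_exp sqr_sqrtr; first exact: size1_polyC.
    by have := q0 0; rewrite {1}(size1_polyC sq) hornerC.
  apply: sos_upolyDsqr; last exact: size_polyC_sqrt.
  by exists 0%N, (fun _ => 0); rewrite big_ord0; split=> // -[].
have [c cmin] := poly_nonneg_min q0.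
have /factor_theorem[h hE] : root (q - q.[c]%:P) c.
  by rewrite /root !hornerE subrr.
have hP t : 0 <= h.[t] * (t - c).
  by have := cmin t; rewrite -subr_ge0 -[q.[c]](hornerC _ t) -hornerN -hornerD hE !hornerE.
(* The quotient [h] has the sign of [t - c], so it is nonnegative at [c] from the right and
   nonpositive from the left: [c] is a double root. *)
have hc0 : 0 <= h.[c].
  apply: poly_ge0_adherent => e e0; exists (c + e / 2); split.
    by rewrite addrAC subrr add0r gtr0_norm; lra.
  by have := hP (c + e / 2); rewrite addrAC subrr add0r pmulr_lge0; lra.
have hc0' : 0 <= (- h).[c].
  apply: poly_ge0_adherent => e e0; exists (c - e / 2); split.
    by rewrite addrAC subrr add0r normrN gtr0_norm; lra.
  have := hP (c - e / 2); rewrite addrAC subrr add0r hornerN mulrN -mulNr.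
  by rewrite pmulr_lge0; lra.
have /factor_theorem[k kE] : root h c.
  by rewrite /root eq_le hc0 andbT; rewrite hornerN oppr_ge0 in hc0'.
have qE : q = k * ('X - c%:P) ^+ 2 + q.[c]%:P.
  by rewrite expr2 mulrA -kE -hE subrK.
have k0 t : t != c -> 0 <= k.[t].
  move=> tc; have := hP t; rewrite kE !hornerE -mulrA -expr2 pmulr_lge0 //.
  by rewrite lt_def sqr_ge0 sqrf_eq0 subr_eq0 tc.
have k0' t : 0 <= k.[t].
  have [->|] := eqVneq t c; last exact: k0.
  apply: poly_ge0_adherent => e e0; exists (c + e / 2); split.
    by rewrite addrAC subrr add0r gtr0_norm; lra.
  by apply: k0; rewrite gt_eqF //; lra.
(* Dividing out the double root lowers the degree by two, which matches the step from [d.+1] to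
   [d]. *)
have sk : (size k <= (2 * d).+1)%N.
  have [->|kn0] := eqVneq k 0; first by rewrite size_poly0.
  have : (size (k * ('X - c%:P) ^+ 2)%R <= (2 * d.+1).+1)%N.
    have -> : k * ('X - c%:P) ^+ 2 = q - q.[c]%:P by rewrite expr2 mulrA -kE -hE.
    rewrite (leq_trans (size_polyD _ _)) // geq_max sq size_polyN.
    by rewrite (leq_trans (size_polyC_leq1 _)).
  rewrite size_proper_mul; last first.
    by rewrite lead_coef_exp lead_coefXsubC expr1n mulr1 lead_coef_eq0.
  by rewrite size_exp_XsubC !addnS addn0 /= mulnS !addSn add0n.
have [l [qs [sqs kqs]]] := IHd k k0' sk.
rewrite qE addrC.
have -> : q.[c]%:P = (Num.sqrt q.[c])%:P ^+ 2 by rewrite -polyC_exp sqr_sqrtr.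
apply: sos_upolyDsqr; last exact: size_polyC_sqrt.
exists l, (fun i => qs i * ('X - c%:P)); split.
  move=> i; rewrite (leq_trans (size_polyMleq _ _)) // size_XsubC addnS addn1.
  by rewrite /= ltnS.
by rewrite kqs mulr_suml; apply: eq_bigr => i _; rewrite exprMn.
Qed.

End UnivariateSOS.

(** * Gram factorization of positive semidefinite forms *)

Section Gram.
Context (R : realType).

Lemma mul_bounded_eq0 (s c : R) : (forall t, 0 <= t * s + c) -> s = 0.
Proof.
move=> h; apply/eqP/negP => /negP s0.
by have := h (- (c + 1) / s); rewrite divfK //; lra.
Qed.

(** Cholesky factorization by induction on the size: the first row is split off, and the induction
    applies to the remaining block, corrected to the Schur complement when the pivot [a] is
    nonzero. *)
Lemma psd_gram k (A : 'I_k -> 'I_k -> R) :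
  (forall i j, A i j = A j i) ->
  (forall v : 'I_k -> R, 0 <= \sum_i \sum_j v i * v j * A i j) ->
  exists B : 'I_k -> 'I_k -> R, forall i j, A i j = \sum_l B l i * B l j.
Proof.
elim: k A => [|k IHk] A Asym Apsd; first by exists (fun _ _ => 0) => -[].
pose a := A ord0 ord0; pose b i := A ord0 (lift ord0 i).
pose A' i j := A (lift ord0 i) (lift ord0 j).
have form t (v : 'I_k -> R) :
    0 <= t ^+ 2 * a + 2 * t * (\sum_j v j * b j) + \sum_i \sum_j v i * v j * A' i j.
  pose w i := if unlift ord0 i is Some j then v j else t.
  have w0 : w ord0 = t by rewrite /w unlift_none.
  have wS i : w (lift ord0 i) = v i by rewrite /w liftK.
  have := Apsd w; rewrite big_ord_recl big_ord_recl w0.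
  under eq_bigr do rewrite wS.
  under [X in _ + X]eq_bigr => i _.
    rewrite big_ord_recl w0 wS; under eq_bigr do rewrite wS.
  over.
  rewrite big_split /=; set S := \sum_i \sum_j _.
  have -> : \sum_i v i * t * A (lift ord0 i) ord0 = t * \sum_j v j * b j.
    by rewrite mulr_sumr; apply: eq_bigr => i _; rewrite Asym /b; ring.
  have -> : \sum_i t * v i * A ord0 (lift ord0 i) = t * \sum_j v j * b j.
    by rewrite mulr_sumr; apply: eq_bigr => i _; rewrite /b; ring.
  by rewrite -/a -/S; congr (_ <= _); ring.
have a0 : 0 <= a.
  have := form 1 (fun _ => 0); rewrite big1 => [|i _]; last by rewrite mul0r.
  rewrite big1 => [|i _]; last by rewrite big1 // => j _; rewrite !mul0r.
  by rewrite expr1n mul1r mulr0 !addr0.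
have [a_eq0|an0] := eqVneq a 0.
  (* With a zero pivot the form is affine in [t], so nonnegativity for all [t] kills its slope; for
     [v = b] the slope is the sum of the squares of the [b j]. *)
  have b0 i : b i = 0.
    have : \sum_j b j * b j = 0.
      apply: (@mul_bounded_eq0 _ (\sum_i \sum_j b i * b j * A' i j)) => t.
      have := form (t / 2) b; rewrite a_eq0 mulr0 add0r.
      by rewrite [2 * _]mulrC divfK // pnatr_eq0.
    move/eqP; rewrite psumr_eq0 => [|j _]; last by rewrite -expr2 sqr_ge0.
    by move/allP/(_ i (mem_index_enum _)); rewrite /= mulf_eq0 orbb => /eqP.
  have [|v|B BE] := IHk A'.
  - by move=> i j; rewrite /A' Asym.
  - by have := form 0 v; rewrite expr0n /= mulr0 !mul0r !add0r.
  exists (fun l i => if unlift ord0 l is Some l' then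
                if unlift ord0 i is Some i' then B l' i' else 0 else 0).
  move=> i j; rewrite big_ord_recl unlift_none mul0r add0r.
  under eq_bigr do rewrite liftK.
  case: (unliftP ord0 i) => [i' ->|->]; case: (unliftP ord0 j) => [j' ->|->].
  - exact: BE.
  - by rewrite Asym -/(b i') b0 big1 // => l _; rewrite mulr0.
  - by rewrite -/(b j') b0 big1 // => l _; rewrite mul0r.
  - by rewrite -/a a_eq0 big1 // => l _; rewrite mul0r.
have agt0 : 0 < a by rewrite lt_def an0.
have [|v|B BE] := IHk (fun i j => A' i j - b i * b j / a).
- by move=> i j; rewrite /A' Asym [b i * _]mulrC.
- pose s := \sum_j v j * b j.
  (* This [t] minimizes the form for fixed [v], and the minimum is the Schur complement at [v]. *)
  have := form (- s / a) v; rewrite -/s.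
  have -> : (- s / a) ^+ 2 * a + 2 * (- s / a) * s = - (s * (s / a)) by field.
  congr (_ <= _); rewrite [LHS]addrC {1}/s mulr_suml -sumrB.
  apply: eq_bigr => i _; rewrite /s mulr_suml mulr_sumr -sumrB.
  by apply: eq_bigr => j _; field.
pose ra := Num.sqrt a.
have ra2 : ra * ra = a by rewrite -expr2 sqr_sqrtr.
have ra0 : ra != 0 by rewrite gt_eqF // sqrtr_gt0.
exists (fun l i => if unlift ord0 l is Some l' then
              if unlift ord0 i is Some i' then B l' i' else 0
            else if unlift ord0 i is Some i' then b i' / ra else ra).
move=> i j; rewrite big_ord_recl unlift_none.
under eq_bigr do rewrite liftK.
case: (unliftP ord0 i) => [i' ->|->]; case: (unliftP ord0 j) => [j' ->|->].
- by rewrite -BE -/(A' i' j') -ra2; field.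
- rewrite Asym -/(b i') big1 => [|l _]; last by rewrite mulr0.
  by rewrite addr0 divfK.
- rewrite -/(b j') big1 => [|l _]; last by rewrite mul0r.
  by rewrite addr0 mulrC divfK.
- by rewrite -/a -ra2 big1 ?addr0 // => l _; rewrite mul0r.
Qed.

Lemma deriv_sum k (F : 'I_k -> {poly R}) :
  (\sum_i F i)^`() = \sum_i (F i)^`().
Proof. exact: raddf_sum. Qed.

Let cf (i j : nat) : R := ((i + j).+1 * (i + j).+2)%:R^-1.

(* [cf i j] is the integral of [(1 - s) * s ^+ (i + j)] over the unit interval. *)
Lemma integral_form_ge0 k (v : 'I_k -> R) :
  0 <= \sum_i \sum_j v i * v j * cf i j.
Proof.
pose w := \sum_i v i *: 'X^i : {poly R}.
(* [W] is the second antiderivative of [w ^+ 2] that vanishes at 0 with its derivative; its value at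
   1 is the form. Two monotonicity arguments then give [0 <= W.[1]]. *)
pose W := \sum_(i < k) \sum_(j < k) (v i * v j * cf i j) *: 'X^((i + j).+2).
have W2 : W^`()^`() = w ^+ 2.
  rewrite expr2 /w mulr_suml /W !deriv_sum; apply: eq_bigr => i _.
  rewrite mulr_sumr !deriv_sum; apply: eq_bigr => j _.
  rewrite !derivZ derivXn derivMn derivXn /= -!scaler_nat !scalerA.
  rewrite -scalerAl -scalerAr -exprD scalerA /cf; congr (_ *: _).
  have A0 : (i + j).+1%:R != 0 :> R by rewrite pnatr_eq0.
  have B0 : (i + j).+2%:R != 0 :> R by rewrite pnatr_eq0.
  rewrite natrM; move: (_.+1%:R) (_.+2%:R) A0 B0 => A B A0 B0.
  by field; rewrite A0 B0.
have W0 : W.[0] = 0.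
  rewrite /W horner_sum big1 // => i _; rewrite horner_sum big1 // => j _.
  by rewrite hornerZ hornerXn expr0n mulr0.
have W1 : W^`().[0] = 0.
  rewrite /W deriv_sum horner_sum big1 // => i _.
  rewrite deriv_sum horner_sum big1 // => j _.
  by rewrite derivZ derivXn hornerZ hornerMn hornerXn expr0n mul0rn mulr0.
have -> : \sum_i \sum_j v i * v j * cf i j = W.[1].
  rewrite /W horner_sum; apply: eq_bigr => i _.
  rewrite horner_sum; apply: eq_bigr => j _.
  by rewrite hornerZ hornerXn expr1n mulr1.
have dW t : 0 <= t -> 0 <= W^`().[t].
  move=> t0; rewrite -W1; apply: (@ler_hornerW R 0 t) => //; rewrite ?in_itv /= ?lexx ?t0 //.
  by move=> s _; rewrite W2 horner_exp sqr_ge0.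
rewrite -W0; apply: (@ler_hornerW R 0 1) => //; rewrite ?in_itv /= ?lexx ?ler01 //.
by move=> s; rewrite in_itv /= => /andP[/ltW s0 _]; apply: dW.
Qed.

Lemma integral_form_gram k : exists B : 'I_k -> 'I_k -> R,
  forall i j : 'I_k, ((i + j).+1 * (i + j).+2)%:R^-1 = \sum_l B l i * B l j.
Proof.
apply: psd_gram; last exact: integral_form_ge0.
by move=> i j; rewrite addnC.
Qed.

End Gram.

From mathcomp Require Import mpoly.

(** * Translation, Euler operator and degrees of multivariate polynomials *)

Section MPolyAux.
Context (R : realType) (n : nat).
Implicit Types (p q : {mpoly R[n]}).

Lemma mpoly_alg_ind (P : {mpoly R[n]} -> Prop) :
  (forall c, P c%:MP) -> (forall i, P 'X_i) ->
  (forall p q, P p -> P q -> P (p + q)) ->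
  (forall p q, P p -> P q -> P (p * q)) -> forall p, P p.
Proof.
move=> PC PX PD PM p; rewrite [p]mpolyE.
apply: (big_ind P); [by rewrite -mpolyC0 | exact: PD | move=> m _].
rewrite -mul_mpolyC; apply: (PM) => //; rewrite mpolyXE_id.
apply: (big_ind P); [by rewrite -mpolyC1 | exact: PM | move=> i _].
elim: (m i) => [|k IHk]; first by rewrite expr0 -mpolyC1.
by rewrite exprS; apply: PM.
Qed.

Lemma submm (m : 'X_{1..n}) : (m - m = 0)%MM.
Proof. by apply/mnmP => i; rewrite mnmBE subnn mnm0E. Qed.

Lemma msizeM_leq p q j k :
  (msize p <= j.+1)%N -> (msize q <= k.+1)%N -> (msize (p * q) <= (j + k).+1)%N.
Proof.
move=> pj qk; have [->|p0] := eqVneq p 0; first by rewrite mul0r msize0.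
have [->|q0] := eqVneq q 0; first by rewrite mulr0 msize0.
by rewrite msizeM //; have := leq_add pj qk; rewrite addSn addnS; case: (_ + _)%N.
Qed.

Lemma msize_sum_leq (I : Type) (s : seq I) (P : pred I) (F : I -> {mpoly R[n]}) k :
  (forall i, P i -> msize (F i) <= k)%N -> (msize (\sum_(i <- s | P i) F i) <= k)%N.
Proof.
move=> Fk; apply: (big_ind (fun p => (msize p <= k)%N)) => //; first by rewrite msize0.
move=> x y hx hy.
by rewrite (leq_trans (msizeD_le _ _)) // geq_max hx hy.
Qed.

(** The polynomial [p] recentred at [a]: its coefficients are the Taylor coefficients of [p] at
    [a]. *)
Definition mtranslate (a : 'I_n -> R) p : {mpoly R[n]} :=
  p \mPo [tuple 'X_i + (a i)%:MP | i < n].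

Lemma mtranslateC a c : mtranslate a c%:MP = c%:MP.
Proof. exact: comp_mpolyC. Qed.

Lemma mtranslateX a i : mtranslate a 'X_i = 'X_i + (a i)%:MP.
Proof. by rewrite /mtranslate comp_mpolyXU -tnth_nth tnth_mktuple. Qed.

Lemma mtranslateD a : {morph mtranslate a : p q / p + q}.
Proof. exact: comp_mpolyD. Qed.

Lemma mtranslateM a : {morph mtranslate a : p q / p * q}.
Proof. by move=> p q; rewrite /mtranslate rmorphM. Qed.

Lemma mtranslateZ a c p : mtranslate a (c *: p) = c *: mtranslate a p.
Proof. by rewrite -!mul_mpolyC mtranslateM mtranslateC. Qed.

Lemma mtranslateXn a p k : mtranslate a (p ^+ k) = mtranslate a p ^+ k.
Proof. by rewrite /mtranslate rmorphXn. Qed.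

Lemma mtranslate_sum a (I : Type) (s : seq I) (P : pred I) F :
  mtranslate a (\sum_(i <- s | P i) F i) = \sum_(i <- s | P i) mtranslate a (F i).
Proof. by rewrite /mtranslate rmorph_sum. Qed.

Lemma meval_mtranslate a p x :
  (mtranslate a p).@[x] = p.@[fun i => x i + a i].
Proof.
rewrite /mtranslate comp_mpoly_meval; apply: meval_eq => i.
by rewrite tnth_mktuple mevalD mevalXU mevalC.
Qed.

Lemma mtranslateNK a p : mtranslate (fun i => - a i) (mtranslate a p) = p.
Proof.
elim/mpoly_alg_ind: p => [c|i|p q hp hq|p q hp hq].
- by rewrite !mtranslateC.
- by rewrite mtranslateX mtranslateD mtranslateX mtranslateC mpolyCN subrK.
- by rewrite !mtranslateD hp hq.
- by rewrite !mtranslateM hp hq.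
Qed.

Lemma mderiv_mtranslate a i p :
  mderiv i (mtranslate a p) = mtranslate a (mderiv i p).
Proof.
elim/mpoly_alg_ind: p => [c|j|p q hp hq|p q hp hq].
- by rewrite mtranslateC mderivC -mpolyC0 mtranslateC.
- rewrite mtranslateX mderivD mderivC addr0 mderivX mtranslateZ mnm1E.
  case: eqP => [->|_]; last by rewrite !scale0r.
  by rewrite submm mpolyX0 -mpolyC1 mtranslateC.
- by rewrite mtranslateD !mderivD mtranslateD hp hq.
- by rewrite mtranslateM !mderivM mtranslateD !mtranslateM hp hq.
Qed.

Lemma msize_mtranslate a p k :
  (msize p <= k)%N -> (msize (mtranslate a p) <= k)%N.
Proof.
move=> pk; rewrite [p]mpolyE mtranslate_sum big_seq.
apply: msize_sum_leq => m /msize_mdeg_lt mp.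
rewrite mtranslateZ (leq_trans (msizeZ_le _ _)) // (leq_trans _ (leq_trans mp pk)) //.
rewrite mpolyXE_id /mtranslate rmorph_prod mdegE /=.
apply: (big_ind2 (fun (q : {mpoly R[n]}) d => (msize q <= d.+1)%N)) => [|x1 x2 y1 y2|i _].
- by rewrite msize1.
- exact: msizeM_leq.
- rewrite rmorphXn /=; elim: (m i) => [|l IHl]; first by rewrite expr0 msize1.
  rewrite exprS; apply: (@msizeM_leq _ _ 1 l) => //.
  rewrite -/(mtranslate a 'X_i) mtranslateX (leq_trans (msizeD_le _ _)) //.
  by rewrite geq_max msizeX mdeg1 msizeC /=; case: eqP.
Qed.

(** The Euler operator, which is diagonal on monomials, with the total degree as eigenvalue. *)
Definition euler p : {mpoly R[n]} := \sum_i 'X_i * mderiv i p.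

Lemma mcoeff_euler p m : (euler p)@_m = (mdeg m)%:R * p@_m.
Proof.
rewrite /euler raddf_sum /= mdegE natr_sum mulr_suml; apply: eq_bigr => i _.
have [mi0|mi] := eqVneq (m i) 0%N.
  rewrite mi0 mul0r; apply/eqP; rewrite mcoeff_eq0; apply/negP.
  rewrite mulrC => h; have := msuppMX (mderiv i p) U_(i).
  move/perm_mem => e; rewrite e in h; case/mapP: h => m' _ mE.
  by move: mi0; rewrite mE mnmDE mnm1E eqxx.
have mE : (U_(i) + (m - U_(i)))%MM = m by rewrite addmC submK // lep1mP.
rewrite mulrC -{1}mE mcoeffMX mcoeff_deriv addmC mE mnmBE mnm1E eqxx subn1.
by rewrite prednK ?lt0n // mulr_natl.
Qed.

(** The product rule applied to [euler (euler p)] yields the Hessian form plus [euler p]. Hence the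
    Hessian form is diagonal on monomials too, with eigenvalue [|m| (|m| - 1)]. *)
Lemma hessian_form p :
  \sum_i \sum_j 'X_i * 'X_j * mderiv i (mderiv j p) = euler (euler p) - euler p.
Proof.
apply/eqP; rewrite eq_sym subr_eq; apply/eqP.
rewrite {1}/euler -big_split /=; apply: eq_bigr => i _.
rewrite /euler raddf_sum /= mulr_sumr.
rewrite (eq_bigr (fun j => 'X_i * ((U_(j)%MM i)%:R *: 'X_[U_(j) - U_(i)] * mderiv j p)
    + 'X_i * ('X_j * mderiv i (mderiv j p)))); last first.
  by move=> j _; rewrite mderivM mderivX mulrDr.
rewrite big_split /= addrC; congr (_ + _).
  by apply: eq_bigr => j _; rewrite mulrA.
rewrite (bigD1 i) //= big1 => [|j ji].
  by rewrite mnm1E eqxx submm mpolyX0 scale1r mul1r addr0.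
by rewrite mnm1E (negPf ji) scale0r mul0r mulr0.
Qed.

Lemma mcoeff_hessian_form p m :
  (\sum_i \sum_j 'X_i * 'X_j * mderiv i (mderiv j p))@_m
  = (mdeg m)%:R * ((mdeg m)%:R - 1) * p@_m.
Proof. by rewrite hessian_form mcoeffB !mcoeff_euler; ring. Qed.

(* The squares of the leading coefficients cannot cancel. *)
Lemma msize_sum_sqr k (q : 'I_k -> {mpoly R[n]}) r :
  (msize (\sum_i q i ^+ 2) <= (2 * r).+1)%N -> forall i, (msize (q i) <= r.+1)%N.
Proof.
move=> sr i0; rewrite leqNgt; apply/negP => ri0.
pose i1 := [arg max_(i > i0) mlead (q i)]%O.
have i1max i : (mlead (q i) <= mlead (q i1))%O.
  by rewrite /i1; case: Order.TotalTheory.arg_maxP => // j _ /(_ i isT).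
set m := mlead (q i1) in i1max.
have qi0 : q i0 != 0 by apply: contraTneq ri0 => ->; rewrite msize0.
have mr : (r < mdeg m)%N.
  apply: leq_trans (lemc_mdeg (i1max i0)).
  by rewrite -ltnS mlead_deg.
have q1 : q i1 != 0.
  by apply: contraTneq mr => q0; rewrite /m q0 mlead0 mdeg0.
(* Since [m] dominates every leading monomial, the coefficient at [m + m] is the sum of the squares
   of the coefficients at [m], one of which is nonzero. *)
have : (\sum_i q i ^+ 2)@_(m + m) = 0.
  apply/memN_msupp_eq0/msize_mdeg_ge; rewrite mdegD addnn -mul2n.
  by rewrite (leq_trans sr) // ltn_mul2l.
rewrite raddf_sum /=.
under eq_bigr => i _ do rewrite expr2 mleadcMW //.
move/eqP; rewrite psumr_eq0 => [|i _]; last by rewrite -expr2 sqr_ge0.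
move/allP/(_ i1 (mem_index_enum _)); rewrite /= mulf_eq0 orbb mleadc_eq0.
by rewrite (negPf q1).
Qed.

End MPolyAux.

(** * Taylor expansion of SOS-convex polynomials with a sum-of-squares remainder *)

Section SOSConvex.
Context (R : realType) (n : nat).
Implicit Types (p q : {mpoly R[n]}).

Lemma msize_leq p k : (forall m, (k <= mdeg m)%N -> p@_m = 0) -> (msize p <= k)%N.
Proof.
move=> pk; rewrite msizeE; apply/bigmax_leqP_seq => m mp _.
by rewrite ltnNge; apply: contraL mp => /pk/eqP; rewrite mcoeff_eq0.
Qed.

Lemma mcoeff_sqr_wide (c : 'X_{1..n} -> R) k m :
  ((\sum_(i : 'X_{1..n < k}) c i *: 'X_[i]) ^+ 2)@_m
  = \sum_(i : 'X_{1..n < k}) \sum_(j : 'X_{1..n < k})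
      c i * c j * ((i + j)%MM == m)%:R.
Proof.
rewrite expr2 mulr_suml raddf_sum /=; apply: eq_bigr => i _.
rewrite mulr_sumr raddf_sum /=; apply: eq_bigr => j _.
by rewrite -scalerAl -scalerAr -mpolyXD !mcoeffZ mcoeffX mulrA.
Qed.

(* The operator dividing the coefficient of [X^m] by [|m| (|m| - 1)] maps a
   square to a sum of squares, since [(1 / ((a + b) (a + b - 1)))_(a, b >= 1)]
   is a Gram matrix. *)
Lemma sqr_div_degree r (h : {mpoly R[n]}) :
  (msize h <= r.+1)%N -> h@_0%MM = 0 ->
  exists q : 'I_r.+1 -> {mpoly R[n]},
    [/\ forall t, (msize (q t) <= r.+1)%N, forall t, (q t)@_0%MM = 0 &
        forall m, (\sum_t q t ^+ 2)@_m
                  = (mdeg m * (mdeg m).-1)%:R^-1 * (h ^+ 2)@_m].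
Proof.
move=> hr h0; have [B BE] := integral_form_gram R r.+1.
(* The Gram index is [|m| - 1], so that indices of [i] and [j] give the denominator for degree
   [|i| + |j|]. The truncated predecessor at [m = 0] is harmless because [h] has no constant
   term. *)
pose c t (m : 'X_{1..n}) := B t (inord (mdeg m).-1) * h@_m.
exists (fun t => \sum_(i : 'X_{1..n < r.+1}) c t i *: 'X_[i]); split=> [t|t|m].
- apply: msize_sum_leq => i _; rewrite (leq_trans (msizeZ_le _ _)) // msizeX.
  exact: bmdeg.
- rewrite raddf_sum big1 //= => i _; rewrite mcoeffZ mcoeffX.
  by case: eqP => [i0|_]; rewrite ?mulr0 // /c i0 h0 mulr0 mul0r.
rewrite raddf_sum /=; under eq_bigr => t _ do rewrite (mcoeff_sqr_wide (c t)).
rewrite {1}(mpolywE hr) (mcoeff_sqr_wide (fun l => h@_l)) exchange_big mulr_sumr /=.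
apply: eq_bigr => i _; rewrite exchange_big mulr_sumr /=; apply: eq_bigr => j _.
rewrite -mulr_suml mulrA; case: eqP => [ijm|_]; last by rewrite !mulr0.
rewrite !mulr1 /c.
have [->|hi] := eqVneq h@_i 0.
  by rewrite mul0r mulr0 big1 // => t _; rewrite mulr0 mul0r.
have [->|hj] := eqVneq h@_j 0.
  by rewrite !mulr0 big1 // => t _; rewrite mulr0 mulr0.
have dpos (l : 'X_{1..n}) : h@_l != 0 -> (0 < mdeg l)%N.
  by rewrite lt0n; apply: contraNneq => /eqP; rewrite mdeg_eq0 => /eqP->; rewrite h0.
have := BE (inord (mdeg i).-1) (inord (mdeg j).-1).
rewrite !inordK ?(leq_ltn_trans (leq_pred _)) ?bmdeg // => BE'.
transitivity ((\sum_l B l (inord (mdeg i).-1) * B l (inord (mdeg j).-1)) * (h@_i * h@_j)).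
  by rewrite mulr_suml; apply: eq_bigr => t _; ring.
rewrite -BE' -ijm mdegD; congr (_%:R^-1 * _).
move: (dpos _ hi) (dpos _ hj); case: (mdeg i) (mdeg j) => [//|x] [//|y] _ _.
by rewrite addSn addnS mulnC.
Qed.

(** With Hessian [F^T F], the form at [x] of the Hessian taken at [x + a] is the squared norm of
    [F(x + a) x]; the entries of this vector vanish at the origin. *)
Lemma sos_convex_form p a : sos_convex p ->
  exists (k : nat) (h : 'I_k -> {mpoly R[n]}), (forall l, (h l)@_0%MM = 0) /\
    \sum_i \sum_j 'X_i * 'X_j * mderiv i (mderiv j (mtranslate a p))
    = \sum_l h l ^+ 2.
Proof.
move=> [k [F HF]].
exists k, (fun l => \sum_i 'X_i * mtranslate a (F l i)); split=> [l|].
  rewrite raddf_sum big1 //= => i _.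
  by rewrite rmorphM /= mcoeffX mnm1_eq0 mul0r.
transitivity (\sum_i \sum_j \sum_l
    ('X_i * mtranslate a (F l i)) * ('X_j * mtranslate a (F l j))).
  apply: eq_bigr => i _; apply: eq_bigr => j _.
  rewrite !mderiv_mtranslate.
  have -> : mderiv i (mderiv j p) = hessian p i j by rewrite mxE.
  rewrite HF mxE mtranslate_sum mulr_sumr; apply: eq_bigr => l _.
  by rewrite mxE mtranslateM mulrACA.
under eq_bigr do rewrite exchange_big /=.
rewrite exchange_big /=; apply: eq_bigr => l _.
rewrite expr2 mulr_suml; apply: eq_bigr => i _.
by rewrite -mulr_sumr.
Qed.

(** The Hessian form of the translate is a sum of squares whose coefficients carry the factor
    [|m| (|m| - 1)]. Its degree bounds that of each square, and dividing by the factor recovers all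
    terms of degree at least 2 as a sum of squares. *)
Lemma sos_convex_taylor r p a : sos_convex p -> mdeg_le p (2 * r) ->
  exists (c : R) (b : 'I_n -> R) (I : finType) (q : I -> {mpoly R[n]}),
    [/\ forall i, mdeg_le (q i) r, forall i, (q i)@_0%MM = 0 &
        mtranslate a p = c%:MP + \sum_j b j *: 'X_j + \sum_i q i ^+ 2].
Proof.
move=> cp dp; have [k [h [h0 hE]]] := sos_convex_form a cp.
have hG m : (\sum_l h l ^+ 2)@_m
    = (mdeg m)%:R * ((mdeg m)%:R - 1) * (mtranslate a p)@_m.
  by rewrite -hE mcoeff_hessian_form.
have hr : forall l, (msize (h l) <= r.+1)%N.
  apply: msize_sum_sqr; apply: msize_leq => m rm; rewrite hG.
  have := msize_mtranslate a dp => sp.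
  by rewrite (memN_msupp_eq0 (msize_mdeg_ge (leq_trans sp rm))) mulr0.
have /boolp.choice[q qP] : forall l, exists q : 'I_r.+1 -> {mpoly R[n]},
    [/\ forall t, (msize (q t) <= r.+1)%N, forall t, (q t)@_0%MM = 0 &
        forall m, (\sum_t q t ^+ 2)@_m
                  = (mdeg m * (mdeg m).-1)%:R^-1 * (h l ^+ 2)@_m].
  by move=> l; apply: sqr_div_degree.
pose P := mtranslate a p.
exists (P@_0%MM), (fun j => P@_U_(j)), ('I_k * 'I_r.+1)%type, (fun lt => q lt.1 lt.2).
split=> [[l t]|[l t]|].
- by case: (qP l) => qr _ _; exact: qr.
- by case: (qP l) => _ q0 _; exact: q0.
apply/mpolyP => m; rewrite !mcoeffD mcoeffC.
have -> : (\sum_(i : 'I_k * 'I_r.+1) q i.1 i.2 ^+ 2)@_m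
    = (mdeg m * (mdeg m).-1)%:R^-1 * ((mdeg m)%:R * ((mdeg m)%:R - 1) * P@_m).
  rewrite -hG -(pair_bigA _ (fun l t => q l t ^+ 2)) /=.
  rewrite raddf_sum [X in _ * X]raddf_sum mulr_sumr /=.
  by apply: eq_bigr => l _; case: (qP l) => _ _ ->.
have -> : (\sum_j P@_U_(j) *: 'X_j)@_m = \sum_j P@_U_(j) * (U_(j)%MM == m)%:R.
  by rewrite raddf_sum; apply: eq_bigr => j _; rewrite /= mcoeffZ mcoeffX.
(* The factor vanishes in degrees 0 and 1, where [c] and [b] supply the coefficients, and cancels
   from degree 2 on. *)
case dm: (mdeg m) => [|[|e]].
- have m0 : m = 0%MM by apply/eqP; rewrite -mdeg_eq0 dm.
  rewrite big1 => [|j _]; last by rewrite m0 mnm1_eq0 mulr0.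
  by rewrite m0 eqxx mulr1 !mul0r mulr0 !addr0.
- have /mdeg1P[j /eqP mj] : mdeg m == 1%N by rewrite dm.
  rewrite subrr mulr0 mul0r mulr0 addr0 (bigD1 j) //= big1 => [|i ij].
    by rewrite mj mnm1_eq0 eqxx mulr0 mulr1 add0r addr0.
  by rewrite mj eq_mnm1 (negPf ij) mulr0.
- rewrite (negPf (_ : m != 0%MM)); last by rewrite -mdeg_eq0 dm.
  rewrite mulr0 add0r big1 => [|j _]; last first.
    case: eqP => [mj|_]; last by rewrite mulr0.
    by move: dm; rewrite -mj mdeg1.
  have -> : e.+2%:R - 1 = e.+1%:R :> R by rewrite -[1]/(1%:R) -natrB // subn1.
  by rewrite add0r mulrA /= -natrM mulVf ?mul1r // pnatr_eq0 muln_eq0.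
Qed.

Lemma sos_convexC (c : R) : sos_convex (mpolyC n c).
Proof.
exists 0%N, 0; apply/matrixP => i j; rewrite !mxE big_ord0.
by rewrite mderivC mderiv0.
Qed.

Lemma sos_convexD p q : sos_convex p -> sos_convex q -> sos_convex (p + q).
Proof.
move=> [k [F HF]] [l [G HG]]; exists (k + l)%N, (col_mx F G).
rewrite tr_col_mx mul_row_col -HF -HG.
by apply/matrixP => i j; rewrite !mxE !mderivD.
Qed.

Lemma sos_convexZ (c : R) p : 0 <= c -> sos_convex p -> sos_convex (c *: p).
Proof.
move=> c0 [k [F HF]]; exists k, ((Num.sqrt c)%:MP *: F).
apply/matrixP => i j; have := congr1 (fun M : 'M_n => M i j) HF.
rewrite !mxE !mderivZ => ->; rewrite scaler_sumr; apply: eq_bigr => l _.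
rewrite !mxE -mul_mpolyC -{1}(sqr_sqrtr c0) expr2 mpolyCM; ring.
Qed.

End SOSConvex.

(** * Minimizers of convex multivariate polynomials *)

Section ConvexPolyMin.
Context (R : realType) (n : nat).

Lemma cont_meval N (p : {mpoly R[n]}) (y : 'I_n -> 'rV[R]_N -> R) :
  (forall i, cont (y i)) -> cont (fun x => p.@[y^~ x]).
Proof.
move=> cy; elim/mpoly_alg_ind: p => [c|i|p q hp hq|p q hp hq].
- by under boolp.eq_fun do rewrite mevalC; exact: cont_cst.
- by under boolp.eq_fun do rewrite mevalXU; exact: cy.
- by under boolp.eq_fun do rewrite mevalD; exact: contD.
- by under boolp.eq_fun do rewrite mevalM; exact: contM.
Qed.

Lemma meval_line (p : {mpoly R[n]}) (x d : 'I_n -> R) :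
  exists h : {poly R}, forall t, h.[t] = p.@[fun i => x i + t * d i].
Proof.
elim/mpoly_alg_ind: p => [c|i|p q [h hE] [k kE]|p q [h hE] [k kE]].
- by exists c%:P => t; rewrite hornerC mevalC.
- by exists ((x i)%:P + d i *: 'X) => t; rewrite mevalXU !hornerE mulrC.
- by exists (h + k) => t; rewrite hornerD hE kE mevalD.
- by exists (h * k) => t; rewrite hornerM hE kE mevalM.
Qed.

Lemma mpoly_convex_min (L : {mpoly R[n]}) (c : R) :
  convex_fun (fun x => L.@[x]) -> (forall x, c <= L.@[x]) ->
  exists a, forall x, L.@[a] <= L.@[x].
Proof.
move=> cL Lc.
have [|x y t t0 t1|x d|x|x0 x0min] :=
    @convex_polyline_min R n (fun x : 'rV[R]_n => L.@[fun i => x 0 i]) _ _ _ c _.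
- move=> t; apply: (@cont_meval n L (fun i (x : 'rV[R]_n) => (t *: x) 0 i)) => i.
  under boolp.eq_fun do rewrite mxE.
  by apply: contM; [exact: cont_cst | exact: cont_coord].
- apply: le_trans (cL (fun i => x 0 i) (fun i => y 0 i) t t0 t1).
  by rewrite le_eqVlt; apply/orP; left; apply/eqP; apply: meval_eq => i; rewrite !mxE.
- have [h hE] := meval_line L (fun i => x 0 i) (fun i => d 0 i).
  by exists h => t; rewrite hE; apply: meval_eq => i; rewrite !mxE.
- exact: Lc.
exists (fun i => x0 0 i) => x; apply: le_trans (x0min (\row_i x i)) _.
by rewrite le_eqVlt; apply/orP; left; apply/eqP; apply: meval_eq => i; rewrite !mxE.
Qed.

End ConvexPolyMin.

(** * Lagrange multipliers under Slater's condition *)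

Section Lagrange.
Context (R : realType) (n : nat).
Implicit Types (x y : 'I_n -> R) (f g : ('I_n -> R) -> R).

Definition convex_set (X : ('I_n -> R) -> Prop) : Prop :=
  forall x y t, 0 <= t -> t <= 1 -> X x -> X y ->
    X (fun k => t * x k + (1 - t) * y k).

Lemma convex_funD f g :
  convex_fun f -> convex_fun g -> convex_fun (fun x => f x + g x).
Proof.
move=> cf cg x y t t0 t1.
by apply: le_trans (lerD (cf x y t t0 t1) (cg x y t t0 t1)) _; lra.
Qed.

Lemma convex_funZ f (c : R) : 0 <= c ->
  convex_fun f -> convex_fun (fun x => c * f x).
Proof.
move=> c0 cf x y t t0 t1.
by apply: le_trans (ler_wpM2l c0 (cf x y t t0 t1)) _; lra.
Qed.

(* The multiplier is the infimum of [(f - v) / g] over [g > 0], up to sign;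
   points with [g > 0] and [g < 0] are compared on the segment joining them. *)
Lemma lagrange_multiplier (X : ('I_n -> R) -> Prop) f g (v : R) :
  convex_set X -> convex_fun f -> convex_fun g ->
  (exists x, X x /\ g x < 0) -> (forall x, X x -> g x <= 0 -> v <= f x) ->
  exists lam, 0 <= lam /\ forall x, X x -> v <= f x + lam * g x.
Proof.
move=> cX cf cg [xh [Xxh gxh]] fv.
have [[x1 [Xx1 gx1]]|nog] := boolp.EM (exists x, X x /\ 0 < g x); last first.
  exists 0; split=> // x Xx; rewrite mul0r addr0; apply: fv => //.
  by rewrite leNgt; apply/negP => gx; apply: nog; exists x.
pose P x := X x /\ 0 < g x; pose phi x := (f x - v) / g x.
have cross x y : P x -> X y -> g y < 0 -> (v - f y) / - g y <= phi x.
  move=> [Xx gx] Xy gy; rewrite /phi ler_pdivrMr ?oppr_gt0 // mulrAC ler_pdivlMr //.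
  have D0 : 0 < g x - g y by lra.
  (* At this weight the convex combination of [g y] and [g x] is zero, so the point on the segment
     is feasible. *)
  pose t := g x / (g x - g y).
  have t0 : 0 <= t by rewrite divr_ge0 ?ltW.
  have t1 : t <= 1 by rewrite ler_pdivrMr // mul1r; lra.
  have tD : t * (g x - g y) = g x by rewrite divfK ?gt_eqF.
  have /fv : X (fun k => t * y k + (1 - t) * x k) by apply: cX.
  have gz : g (fun k => t * y k + (1 - t) * x k) <= 0.
    by apply: le_trans (cg y x t t0 t1) _; lra.
  move=> /(_ gz) vf; have := le_trans vf (cf y x t t0 t1).
  rewrite -(ler_pM2r D0) => h.
  have e : (t * f y + (1 - t) * f x) * (g x - g y)
    = t * (g x - g y) * f y + (g x - g y - t * (g x - g y)) * f x by ring.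
  by rewrite e tD in h; lra.
have [c [cle capp]] := @glb_approx R _ P phi _ x1 (conj Xx1 gx1)
  (fun x Px => cross x xh Px Xxh gxh).
have cge y : X y -> g y < 0 -> (v - f y) / - g y <= c.
  move=> Xy gy; apply/ler_addgt0Pr => e /capp[x [Px xc]].
  by apply: le_trans (cross x y Px Xy gy) (ltW xc).
(* Truncation at 0 ensures the sign. Where [g x < 0] and the maximum is 0, the claim is the
   hypothesis on feasible points. *)
exists (Num.max 0 (- c)); split; first by rewrite le_max lexx.
move=> x Xx; have [gx|gx|gx] := ltgtP (g x) 0.
- have := cge x Xx gx; rewrite ler_pdivrMr ?oppr_gt0 // => h.
  have vf : v <= f x by apply: fv => //; exact: ltW.
  by case: (leP 0 (- c)) => _; lra.
- have := cle x (conj Xx gx); rewrite /phi ler_pdivlMr // => h.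
  have : - c <= Num.max 0 (- c) by rewrite le_max lexx orbT.
  by rewrite -(ler_pM2r gx) => h2; lra.
- by rewrite gx mulr0 addr0; apply: fv; rewrite ?gx.
Qed.

(** The first constraint is eliminated over the convex set cut out by the others; the induction then
    applies to [f + l0 * g ord0], which is again convex, with the same Slater point. *)
Lemma lagrange_multipliers m (g : 'I_m -> ('I_n -> R) -> R) f (v : R) :
  convex_fun f -> (forall i, convex_fun (g i)) ->
  (exists x, forall i, g i x < 0) ->
  (forall x, (forall i, g i x <= 0) -> v <= f x) ->
  exists lam : 'I_m -> R, (forall i, 0 <= lam i) /\
    forall x, v <= f x + \sum_i lam i * g i x.
Proof.
elim: m g f => [|m IHm] g f cf cg [xh gxh] fv.
  by exists (fun _ => 0); split=> // x; rewrite big_ord0 addr0 fv // => -[].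
pose X x := forall i, g (lift ord0 i) x <= 0.
have cX : convex_set X.
  move=> x y t t0 t1 Xx Xy i; apply: le_trans (cg _ _ _ _ t0 t1) _.
  have := Xx i; have := Xy i => hy hx.
  by rewrite -oppr_ge0 opprD -!mulrN addr_ge0 // mulr_ge0 //; lra.
have [||l0 [l00 l0P]] := lagrange_multiplier cX cf (cg ord0) _ _ (v := v).
- by exists xh; split=> [i|]; [exact: ltW | exact: gxh].
- move=> x Xx gx; apply: fv => i.
  by case: (unliftP ord0 i) => [j ->|->]; [exact: Xx | exact: gx].
have [||||lam [lam0 lamP]] :=
    IHm (fun i => g (lift ord0 i)) (fun x => f x + l0 * g ord0 x).
- by apply: convex_funD => //; apply: convex_funZ.
- by move=> i; apply: cg.
- by exists xh => i; apply: gxh.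
- by move=> x Xx; apply: l0P.
exists (fun i => if unlift ord0 i is Some j then lam j else l0); split.
  by move=> i; case: unliftP.
move=> x; rewrite big_ord_recl unlift_none.
by under eq_bigr do rewrite liftK; rewrite addrA; apply: lamP.
Qed.

End Lagrange.

(** * Embedding univariate polynomials; separable polynomials *)

Section UnivEmb.
Context (R : realType) (n : nat).
Implicit Types (q s : {poly R}) (j : 'I_n).

(** As evaluation at ['X_j], the embedding is visibly a ring morphism. *)
Lemma univ_embE j q : univ_emb j q = (map_poly (@mpolyC n R) q).['X_j].
Proof.
rewrite /univ_emb (horner_coef_wide _ (size_poly _ _)).
by apply: eq_bigr => k _; rewrite coef_map /= mul_mpolyC.
Qed.

Lemma univ_embD j : {morph @univ_emb R n j : q s / q + s}.
Proof. by move=> q s; rewrite !univ_embE rmorphD hornerD. Qed.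

Lemma univ_embM j : {morph @univ_emb R n j : q s / q * s}.
Proof. by move=> q s; rewrite !univ_embE rmorphM hornerM. Qed.

Lemma univ_embC j (c : R) : univ_emb j c%:P = c%:MP.
Proof. by rewrite univ_embE map_polyC hornerC. Qed.

Lemma univ_embX j : univ_emb j 'X = 'X_j :> {mpoly R[n]}.
Proof. by rewrite univ_embE map_polyX hornerX. Qed.

Lemma univ_embZ j (c : R) q : univ_emb j (c *: q) = c *: univ_emb j q.
Proof. by rewrite -mul_polyC univ_embM univ_embC mul_mpolyC. Qed.

Lemma univ_emb_sum j (I : Type) (r : seq I) (P : pred I) (F : I -> {poly R}) :
  univ_emb j (\sum_(i <- r | P i) F i) = \sum_(i <- r | P i) univ_emb j (F i).
Proof.
apply: (big_morph _ (univ_embD j)).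
by rewrite -polyC0 univ_embC mpolyC0.
Qed.

Lemma meval_univ_emb j q x : (univ_emb j q).@[x] = q.[x j].
Proof.
elim/poly_ind: q => [|q c IHq].
  by rewrite -polyC0 univ_embC mevalC hornerC.
by rewrite univ_embD univ_embM univ_embX univ_embC mevalD mevalM mevalXU mevalC IHq !hornerE.
Qed.

Lemma mtranslate_univ_emb a j q :
  mtranslate a (univ_emb j q) = univ_emb j (q \Po ('X + (a j)%:P)).
Proof.
elim/poly_ind: q => [|q c IHq].
  by rewrite comp_poly0 -polyC0 univ_embC mtranslateC.
rewrite comp_polyD comp_polyM comp_polyX comp_polyC !univ_embD !univ_embM.
by rewrite mtranslateD mtranslateM IHq univ_embD univ_embX !univ_embC mtranslateX mtranslateC.
Qed.

Lemma msize_univ_emb j q k :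
  (size q <= k.+1)%N -> (msize (univ_emb j q) <= k.+1)%N.
Proof.
move=> qk; apply: msize_sum_leq => i _; rewrite (leq_trans (msizeZ_le _ _)) //.
rewrite mpolyXn msizeX mdegMn mdeg1 mul1n.
exact: leq_trans (ltn_ord i) qk.
Qed.

Lemma sep_polyD (u w : 'I_n -> {poly R}) :
  sep_poly (fun j => u j + w j) = sep_poly u + sep_poly w.
Proof. by rewrite -big_split; apply: eq_bigr => j _; rewrite univ_embD. Qed.

Lemma sep_polyZ (c : R) (u : 'I_n -> {poly R}) :
  sep_poly (fun j => c *: u j) = c *: sep_poly u.
Proof. by rewrite scaler_sumr; apply: eq_bigr => j _; rewrite univ_embZ. Qed.

Lemma sep_poly_sum m (u : 'I_m -> 'I_n -> {poly R}) :
  sep_poly (fun j => \sum_i u i j) = \sum_i sep_poly (u i).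
Proof.
rewrite exchange_big; apply: eq_bigr => j _; exact: univ_emb_sum.
Qed.

End UnivEmb.

(** * Convex univariate polynomials *)

Section ConvexUpoly.
Context (R : realType).
Implicit Types (q s w : {poly R}).

Lemma convex_upolyD q s : convex_upoly q -> convex_upoly s -> convex_upoly (q + s).
Proof.
move=> cq cs x y t t0 t1; rewrite !hornerD.
by apply: le_trans (lerD (cq x y t t0 t1) (cs x y t t0 t1)) _; lra.
Qed.

Lemma convex_upolyZ (c : R) q : 0 <= c -> convex_upoly q -> convex_upoly (c *: q).
Proof.
move=> c0 cq x y t t0 t1; rewrite !hornerZ.
by apply: le_trans (ler_wpM2l c0 (cq x y t t0 t1)) _; lra.
Qed.

Lemma convex_upoly0 : convex_upoly (0 : {poly R}).
Proof. by move=> x y t _ _; rewrite !horner0 !mulr0 addr0. Qed.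

Lemma convex_upoly_linear (b c : R) : convex_upoly (b *: 'X + c%:P).
Proof.
by move=> x y t _ _; rewrite !hornerE le_eqVlt; apply/orP; left; apply/eqP; ring.
Qed.

Lemma convex_upoly_shift q (a : R) :
  convex_upoly q -> convex_upoly (q \Po ('X + a%:P)).
Proof.
move=> cq x y t t0 t1; rewrite !horner_comp !hornerE.
apply: le_trans (cq (x + a) (y + a) t t0 t1).
by rewrite le_eqVlt; apply/orP; left; apply/eqP; congr _.[_]; ring.
Qed.

(** For small [s > 0], convexity gives [s w(t) >= w(s t) >= - s^2 t^2 K(s t)]; dividing by [s] and
    letting [s] tend to 0 yields the claim. This is first-order optimality at 0 without
    derivatives. *)
Lemma convex_upoly_nonneg w (K : {poly R}) :
  convex_upoly w -> w.[0] = 0 -> (forall t, 0 <= w.[t] + t ^+ 2 * K.[t]) ->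
  forall t, 0 <= w.[t].
Proof.
move=> cw w0 wK t.
pose h := w.[t]%:P + (t ^+ 2) *: ('X * (K \Po (t *: 'X))).
have hE e : h.[e] = w.[t] + e * (t ^+ 2 * K.[e * t]).
  rewrite /h hornerD hornerC hornerZ hornerM hornerX horner_comp hornerZ hornerX.
  by rewrite [t * e]mulrC mulrCA.
have -> : w.[t] = h.[0] by rewrite hE mul0r addr0.
apply: poly_ge0_adherent => e e0; exists (Num.min 1 (e / 2)).
set s := Num.min _ _.
have s0 : 0 < s by rewrite lt_min ltr01; lra.
have s1 : s <= 1 by rewrite ge_min lexx.
have se : s <= e / 2 by rewrite ge_min lexx orbT.
split; first by rewrite subr0 gtr0_norm //; lra.
rewrite hE -(pmulr_rge0 _ s0).
have := wK (s * t); have := cw t 0 s (ltW s0) s1.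
by rewrite w0 !mulr0 !addr0 => h1 h2; lra.
Qed.

End ConvexUpoly.

(** * Decomposing a nonnegative Lagrangian at its minimizer *)

Section Decomposition.
Context (R : realType) (n : nat).
Implicit Types (p q : {mpoly R[n]}).

Lemma meval_at0 p : p.@[fun _ => 0] = p@_0%MM.
Proof.
elim/mpoly_alg_ind: p => [c|i|p q hp hq|p q hp hq].
- by rewrite mevalC mcoeffC eqxx mulr1.
- by rewrite mevalXU mcoeffX mnm1_eq0.
- by rewrite mevalD mcoeffD hp hq.
- by rewrite mevalM rmorphM /= hp hq.
Qed.

Lemma sos_mpoly_fin r (I : finType) (q : I -> {mpoly R[n]}) :
  (forall i, mdeg_le (q i) r) -> sos_mpoly r (\sum_i q i ^+ 2).
Proof.
move=> qr; exists #|I|, (fun i => q (enum_val i)); split=> //.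
by rewrite (reindex (@enum_val I I)) //; exact: onW_bij (enum_val_bij I).
Qed.

Lemma sos_mpolyDsqr r s q :
  sos_mpoly r s -> mdeg_le q r -> sos_mpoly r (q ^+ 2 + s).
Proof.
move=> [k [qs [sqs ->]]] sq.
exists k.+1, (fun i => if unlift ord0 i is Some j then qs j else q); split.
  by move=> i; case: unliftP.
by rewrite big_ord_recl unlift_none; under [in RHS]eq_bigr do rewrite liftK.
Qed.

(** On an axis, a polynomial without constant term is divisible by [t], so its square has the form
    [t ^+ 2 * K] required by [convex_upoly_nonneg]. *)
Lemma meval_axis p (j : 'I_n) : p@_0%MM = 0 ->
  exists k : {poly R}, forall t, p.@[fun l => t * (l == j)%:R] = t * k.[t].
Proof.
move=> p0; have [h hE] := meval_line p (fun _ => 0) (fun l => (l == j)%:R).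
have /factor_theorem[k kE] : root h 0.
  apply/eqP; rewrite hE -[RHS]p0 -meval_at0; apply: meval_eq => l.
  by rewrite mul0r addr0.
exists k => t; transitivity h.[t].
  by rewrite hE; apply: meval_eq => l; rewrite add0r.
by rewrite kE hornerM hornerXsubC subr0 mulrC.
Qed.

(* Translate the minimizer [a] to the origin: the linear part of the
   SOS-convex summand is absorbed by the univariate summands, which are then
   convex and critical at the origin. *)
Lemma sep_sos_decomposition r (d : 'I_n -> nat) (w : 'I_n -> {poly R}) p a :
  (forall j, convex_upoly (w j)) -> (forall j, (size (w j) <= (2 * d j).+1)%N) ->
  sos_convex p -> mdeg_le p (2 * r) ->
  (forall x, (sep_poly w + p).@[a] <= (sep_poly w + p).@[x]) ->
  0 <= (sep_poly w + p).@[a] ->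
  exists (sigma : {mpoly R[n]}) (sig : 'I_n -> {poly R}),
    [/\ sos_mpoly r sigma, forall j, sos_upoly (d j) (sig j) &
        sep_poly w + p = sigma + \sum_(j < n) univ_emb j (sig j)].
Proof.
set L := _ + p => cw sw cp dp amin L0.
have [c [b [I [q [qr q0 pE]]]]] := sos_convex_taylor a cp dp.
(* Recentred at [a], augmented by the linear Taylor term of [p], and normalized to vanish at 0. *)
pose wt j := w j \Po ('X + (a j)%:P) + (b j *: 'X + (- (w j).[a j])%:P).
have wtE j t : (wt j).[t] = (w j).[t + a j] - (w j).[a j] + b j * t.
  by rewrite /wt hornerD horner_comp !hornerD hornerX !hornerC hornerZ hornerX; ring.
have wt0 j : (wt j).[0] = 0 by rewrite wtE add0r mulr0 addr0 subrr.
have wtc j : convex_upoly (wt j).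
  by apply: convex_upolyD; [exact: convex_upoly_shift | exact: convex_upoly_linear].
have [La LE] : exists La, mtranslate a L
    = La%:MP + \sum_j univ_emb j (wt j) + \sum_i q i ^+ 2.
  exists (\sum_j (w j).[a j] + c).
  have -> : \sum_j univ_emb j (wt j) = mtranslate a (sep_poly w)
      + \sum_j b j *: 'X_j - (\sum_j (w j).[a j])%:MP.
    rewrite mtranslate_sum (raddf_sum (mpolyC n (R := R))) -big_split -sumrB /=.
    apply: eq_bigr => j _; rewrite mtranslate_univ_emb /wt !univ_embD univ_embZ.
    by rewrite univ_embX univ_embC mpolyCN addrA.
  by rewrite mtranslateD pE mpolyCD; ring.
have LaE : La = L.@[a].
  have -> : L.@[a] = (mtranslate a L).@[fun _ => 0].
    by rewrite meval_mtranslate; apply: meval_eq => i; rewrite add0r.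
  rewrite LE !mevalD mevalC !raddf_sum /= big1 => [|j _]; last first.
    by rewrite meval_univ_emb wt0.
  by rewrite big1 ?addr0 // => i _; rewrite rmorphXn /= meval_at0 q0 expr0n.
(* Along axis [j], minimality at [a] reads [0 <= wt j + s ^+ 2 * K] with [K] the sum of the
   [k i ^+ 2]. *)
have wt_ge0 j t : 0 <= (wt j).[t].
  have /boolp.choice[k kE] := fun i => meval_axis j (q0 i).
  apply: (@convex_upoly_nonneg R (wt j) (\sum_i k i ^+ 2)) => // s.
  have := amin (fun l => s * (l == j)%:R + a l).
  rewrite -meval_mtranslate LE -LaE !mevalD mevalC -addrA lerDl.
  rewrite !raddf_sum /= (bigD1 j) //= big1 => [|l lj]; last first.
    by rewrite meval_univ_emb (negPf lj) mulr0 wt0.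
  rewrite meval_univ_emb eqxx mulr1 addr0 horner_sum mulr_sumr.
  congr (0 <= _ + _); apply: eq_bigr => i _.
  by rewrite rmorphXn /= kE horner_exp exprMn.
pose na i := - a i.
exists (mtranslate na (La%:MP + \sum_i q i ^+ 2)).
exists (fun j => wt j \Po ('X + (na j)%:P)); split.
- rewrite mtranslateD mtranslateC mtranslate_sum.
  have -> : La%:MP = (Num.sqrt La)%:MP_[n] ^+ 2.
    by rewrite expr2 -mpolyCM -expr2 sqr_sqrtr // LaE.
  under eq_bigr do rewrite mtranslateXn.
  apply: sos_mpolyDsqr; last by rewrite /mdeg_le msizeC; case: eqP.
  by apply: sos_mpoly_fin => i; apply: msize_mtranslate; exact: qr.
- move=> j; apply: poly_nonneg_sos => [t|]; first by rewrite horner_comp.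
  rewrite size_comp_poly2 ?size_XaddC //.
  have sX : (size (b j *: 'X + (- (w j).[a j])%:P)%R <= 2)%N.
    rewrite (leq_trans (size_polyD _ _)) // geq_max.
    rewrite (leq_trans (size_scale_leq _ _)) ?size_polyX //=.
    by rewrite (leq_trans (size_polyC_leq1 _)).
  have sc : (size (w j \Po ('X + (a j)%:P))%R <= (2 * d j).+1)%N.
    by rewrite size_comp_poly2 ?size_XaddC.
  (* If [d j = 0], the linear term would exceed the degree bound; nonnegativity at 1 and -1 forces
     [b j = 0]. *)
  case: (posnP (d j)) => [dj0|dj]; last first.
    rewrite (leq_trans (size_polyD _ _)) // geq_max sc (leq_trans sX) //.
    by rewrite ltnS muln_gt0.
  have wC : w j = ((w j)`_0)%:P by apply: size1_polyC; have := sw j; rewrite dj0.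
  have bj : b j = 0.
    have := wt_ge0 j 1; have := wt_ge0 j (-1); rewrite !wtE wC !hornerC; lra.
  by rewrite /wt bj scale0r add0r wC comp_polyC hornerC polyCN subrr size_poly0.
rewrite -{1}(mtranslateNK a L) LE -/na !mtranslateD addrAC; congr (_ + _).
by rewrite mtranslate_sum; apply: eq_bigr => j _; rewrite mtranslate_univ_emb.
Qed.

End Decomposition.

(** * The linear functional of a truncated moment sequence *)

Section Moments.
Context (R : realType) (n D : nat) (y : 'X_{1..n < D.+1} -> R).
Implicit Types (p q : {mpoly R[n]}).

Lemma LfunD p q : Lfun y (p + q) = Lfun y p + Lfun y q.
Proof. by rewrite -big_split; apply: eq_bigr => i _; rewrite mcoeffD mulrDl. Qed.

Lemma LfunZ (c : R) p : Lfun y (c *: p) = c * Lfun y p.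
Proof. by rewrite mulr_sumr; apply: eq_bigr => i _; rewrite mcoeffZ mulrA. Qed.

Lemma Lfun_sum (I : Type) (s : seq I) (P : pred I) (F : I -> {mpoly R[n]}) :
  Lfun y (\sum_(i <- s | P i) F i) = \sum_(i <- s | P i) Lfun y (F i).
Proof.
apply: (big_morph _ LfunD).
by rewrite /Lfun big1 // => i _; rewrite mcoeff0 mul0r.
Qed.

Lemma LfunC (c : R) : Lfun y c%:MP = c * y bm0.
Proof.
rewrite /Lfun (bigD1 bm0) //= mcoeffC eqxx mulr1 big1 ?addr0 // => i.
by rewrite bmeqP /= mcoeffC => /negPf ->; rewrite mulr0 mul0r.
Qed.

(** Positivity of a moment matrix thus means that the functional is nonnegative on squares from the
    span of [v]. *)
Lemma moment_form k (v : 'I_k -> {mpoly R[n]}) (c : 'cV[R]_k) :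
  (c^T *m moment_mx y v *m c) 0 0 = Lfun y ((\sum_i c i 0 *: v i) ^+ 2).
Proof.
rewrite mxE expr2 mulr_suml Lfun_sum.
under [RHS]eq_bigr do rewrite mulr_sumr Lfun_sum.
rewrite exchange_big /=; apply: eq_bigr => j _.
rewrite mxE mulr_suml; apply: eq_bigr => i _.
by rewrite !mxE -scalerAl -scalerAr !LfunZ; ring.
Qed.

Lemma psd_moment_ge0 k (v : 'I_k -> {mpoly R[n]}) (c : 'I_k -> R) :
  psd (moment_mx y v) -> 0 <= Lfun y ((\sum_i c i *: v i) ^+ 2).
Proof.
move=> [_ /(_ (\col_i c i))]; rewrite moment_form.
by under eq_bigr do rewrite mxE.
Qed.

Lemma Lfun_sos_mpoly r s :
  psd (moment_mx y (@mono_vec R n r)) -> sos_mpoly r s -> 0 <= Lfun y s.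
Proof.
move=> yr [k [q [qr ->]]]; rewrite Lfun_sum; apply: sumr_ge0 => i _.
have -> : q i = \sum_l (q i)@_(bmnm (enum_val l)) *: @mono_vec R n r l.
  rewrite {1}(mpolywE (qr i)).
  rewrite (reindex (@enum_val _ {: 'X_{1..n < r.+1}})) //.
  exact: onW_bij (enum_val_bij _).
exact: psd_moment_ge0.
Qed.

Lemma Lfun_sos_upoly j d s :
  psd (moment_mx y (@var_pow_vec R n j d)) -> sos_upoly d s ->
  0 <= Lfun y (univ_emb j s).
Proof.
move=> yd [k [q [qd ->]]]; rewrite univ_emb_sum Lfun_sum.
apply: sumr_ge0 => i _; rewrite expr2 univ_embM -expr2.
have -> : univ_emb j (q i) = \sum_(l < d.+1) (q i)`_l *: @var_pow_vec R n j d l.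
  rewrite univ_embE (horner_coef_wide _ (leq_trans (size_poly _ _) (qd i))).
  by apply: eq_bigr => l _; rewrite coef_map /= mul_mpolyC.
exact: psd_moment_ge0.
Qed.

End Moments.

(** * Moments of a point *)

Section PointMoments.
Context (R : realType) (n D : nat) (x : 'I_n -> R).

(** The moments of the Dirac measure at [x], up to degree [D]. *)
Definition point_moments (m : 'X_{1..n < D.+1}) : R := \prod_i x i ^+ bmnm m i.

Lemma Lfun_point p : (msize p <= D.+1)%N -> Lfun point_moments p = p.@[x].
Proof.
move=> pD; rewrite {2}(mpolywE pD) raddf_sum; apply: eq_bigr => m _.
by rewrite /= mevalZ mevalX.
Qed.

Lemma psd_point_moments k (v : 'I_k -> {mpoly R[n]}) :
  (forall i j, (msize (v i * v j)%R <= D.+1)%N) -> psd (moment_mx point_moments v).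
Proof.
move=> vD; split=> [|c].
  by apply/matrixP => i j; rewrite !mxE mulrC.
rewrite moment_form Lfun_point; first by rewrite rmorphXn sqr_ge0.
rewrite expr2 mulr_suml; apply: msize_sum_leq => i _.
rewrite mulr_sumr; apply: msize_sum_leq => j _.
by rewrite -scalerAl -scalerAr !(leq_trans (msizeZ_le _ _)).
Qed.

End PointMoments.

(** * Weak duality and the equality of the three values *)

Section Duality.
Context (R : realType) (n m r : nat) (d : 'I_n -> nat)
        (f : {mpoly R[n]}) (g : 'I_m -> {mpoly R[n]}).

Lemma meval_lagrangian (lam : 'I_m -> R) (v : R) x :
  (f + \sum_(i < m) lam i *: g i - v%:MP).@[x]
  = f.@[x] + \sum_i lam i * (g i).@[x] - v.
Proof.
rewrite mevalB mevalD mevalC raddf_sum /=; congr (_ + _ - _).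
by apply: eq_bigr => i _; rewrite mevalZ.
Qed.

Lemma convex_lagrangian (lam : 'I_m -> R) (v : R) :
  (forall i, 0 <= lam i) -> convex_fun (fun x => f.@[x]) ->
  (forall i, convex_fun (fun x => (g i).@[x])) ->
  convex_fun (fun x => (f + \sum_(i < m) lam i *: g i - v%:MP).@[x]).
Proof.
move=> lam0 cf cg x y t t0 t1; rewrite !meval_lagrangian.
set z := fun k => _.
have S : \sum_i lam i * (g i).@[z]
    <= t * (\sum_i lam i * (g i).@[x]) + (1 - t) * (\sum_i lam i * (g i).@[y]).
  rewrite !mulr_sumr -big_split; apply: ler_sum => i _ /=.
  by apply: le_trans (ler_wpM2l (lam0 i) (cg i x y t t0 t1)) _; lra.
have := cf x y t t0 t1; rewrite -/z => F.
apply: le_trans (lerD (lerD F S) (lexx (- v))) _; lra.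
Qed.

(** Evaluating the dual identity at a feasible [x] makes the right-hand side nonnegative and the
    multiplier terms nonpositive. *)
Lemma D_feasible_le_CP mu x :
  D_feasible r d f g mu -> CP_feasible g x -> mu <= f.@[x].
Proof.
move=> [lam [sigma [sig [lam0 [k [q [_ sE]]] sig0 LE]]]] gx.
have : 0 <= (f + \sum_(i < m) lam i *: g i - mu%:MP).@[x].
  rewrite LE mevalD sE !raddf_sum /= addr_ge0 ?sumr_ge0 // => [i _|j _].
    by rewrite rmorphXn sqr_ge0.
  have [l [s [_ ->]]] := sig0 j.
  rewrite meval_univ_emb horner_sum sumr_ge0 // => i _.
  by rewrite horner_exp sqr_ge0.
rewrite meval_lagrangian.
have : \sum_i lam i * (g i).@[x] <= 0.
  by apply: sumr_le0 => i _; rewrite mulr_ge0_le0 ?gx.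
lra.
Qed.

(** The same argument with the functional [Lfun y] in place of evaluation at a point; [y bm0 = 1]
    preserves the constant [mu]. *)
Lemma D_feasible_le_Dt mu z :
  D_feasible r d f g mu -> Dt_values r d f g z -> mu <= z.
Proof.
move=> [lam [sigma [sig [lam0 s0 sig0 LE]]]] [y [yg yd yr y1 ->]].
have : 0 <= Lfun y (f + \sum_(i < m) lam i *: g i - mu%:MP).
  rewrite LE LfunD Lfun_sum addr_ge0 ?(Lfun_sos_mpoly yr s0) //.
  by apply: sumr_ge0 => j _; apply: Lfun_sos_upoly (yd j) (sig0 j).
rewrite -mpolyCN !LfunD LfunC y1 mulr1 Lfun_sum.
have : \sum_i Lfun y (lam i *: g i) <= 0.
  by apply: sumr_le0 => i _; rewrite LfunZ mulr_ge0_le0 ?yg.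
lra.
Qed.

Lemma leq_d0 j : (d j <= d0 d)%N.
Proof. exact: leq_bigmax. Qed.

Lemma CP_feasible_Dt x : (r <= d0 d)%N ->
  mdeg_le f (2 * d0 d) -> (forall i, mdeg_le (g i) (2 * d0 d)) ->
  CP_feasible g x -> Dt_values r d f g f.@[x].
Proof.
move=> rd fd gd gx; exists (@point_moments R n (2 * d0 d) x); split.
- by move=> i; rewrite Lfun_point; [exact: gx | exact: gd].
- move=> j; apply: psd_point_moments => a b.
  rewrite /var_pow_vec -exprD mpolyXn msizeX mdegMn mdeg1 mul1n ltnS mul2n -addnn.
  by apply: leq_add; apply: leq_trans (leq_d0 j); rewrite -ltnS ltn_ord.
- apply: psd_point_moments => a b; rewrite mul2n -addnn.
  by apply: msizeM_leq; rewrite msizeX ltnS; apply: leq_trans rd; rewrite -ltnS bmdeg.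
- by rewrite /point_moments big1 // => i _; rewrite mnm0E expr0.
- by rewrite Lfun_point.
Qed.

Lemma msize_sep_poly_add (u : 'I_n -> {poly R}) p :
  (forall j, (size (u j) <= (2 * d j).+1)%N) -> mdeg_le p (2 * r) ->
  (r <= d0 d)%N -> mdeg_le (sep_poly u + p) (2 * d0 d).
Proof.
move=> ud pr rd; rewrite /mdeg_le (leq_trans (msizeD_le _ _)) // geq_max.
apply/andP; split; last by rewrite (leq_trans pr) // ltnS leq_mul2l.
apply: msize_sum_leq => j _; apply: msize_univ_emb.
by rewrite (leq_trans (ud j)) // ltnS leq_mul2l leq_d0.
Qed.

End Duality.

Theorem theorem4 (R : realType) (n m r : nat) (d : 'I_n -> nat)
    (u0 : 'I_n -> {poly R}) (p0 : {mpoly R[n]})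
    (u : 'I_m -> 'I_n -> {poly R}) (p : 'I_m -> {mpoly R[n]}) :
  let f := sep_poly u0 + p0 in
  let g := fun i => sep_poly (u i) + p i in
  (forall j, convex_upoly (u0 j) /\ (size (u0 j) <= (2 * d j).+1)%N) ->
  (forall i j, convex_upoly (u i j) /\ (size (u i j) <= (2 * d j).+1)%N) ->
  sos_convex p0 /\ mdeg_le p0 (2 * r) ->
  (forall i, sos_convex (p i) /\ mdeg_le (p i) (2 * r)) ->
  convex_fun (fun x => f.@[x]) ->
  (forall i, convex_fun (fun x => (g i).@[x])) ->
  (r < d0 d)%N ->
  (exists c : R, forall x, CP_feasible g x -> c <= f.@[x]) ->
  (exists xh, CP_feasible g xh /\ forall i, (g i).@[xh] < 0) ->
  exists v : R,
    [/\ is_inf (CP_values f g) v,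
        is_sup (D_feasible r d f g) v,
        is_inf (Dt_values r d f g) v &
        D_feasible r d f g v].
Proof.
move=> f g hu0 hu [cp0 dp0] hp cf cg rd [c hc] [xh [xhF xhS]].
have [v [vle vapp]] := glb_approx xhF hc.
have vD : D_feasible r d f g v.
  have [lam [lam0 lamP]] := lagrange_multipliers cf cg (ex_intro _ xh xhS) vle.
  (* The Lagrangian is regrouped into its separable part [w] and its SOS-convex part [q], which
     takes the constant [- v]. *)
  pose w j := u0 j + \sum_i lam i *: u i j.
  pose q := p0 + \sum_i lam i *: p i + (- v)%:MP.
  have LE : f + \sum_(i < m) lam i *: g i - v%:MP = sep_poly w + q.
    rewrite sep_polyD sep_poly_sum /q mpolyCN.
    have -> : \sum_i lam i *: g i
        = \sum_i sep_poly (fun j => lam i *: u i j) + \sum_i lam i *: p i.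
      by rewrite -big_split; apply: eq_bigr => i _; rewrite /g scalerDr sep_polyZ.
    by rewrite /f; ring.
  have L0 x : 0 <= (sep_poly w + q).@[x].
    by rewrite -LE meval_lagrangian subr_ge0 lamP.
  have cL : convex_fun (fun x => (sep_poly w + q).@[x]).
    by rewrite -LE; apply: convex_lagrangian.
  have [a amin] := mpoly_convex_min cL L0.
  have [||||sigma [sig [s0 sig0 E]]] :=
      @sep_sos_decomposition R n r d w q a _ _ _ _ amin (L0 a).
  - move=> j; apply: convex_upolyD; first by case: (hu0 j).
    apply: (big_ind (@convex_upoly R)); first exact: convex_upoly0.
      exact: convex_upolyD.
    by move=> i _; apply: convex_upolyZ => //; case: (hu i j).
  - move=> j; rewrite (leq_trans (size_polyD _ _)) // geq_max (hu0 j).2 /=.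
    rewrite (leq_trans (size_sum _ _ _)) //; apply/bigmax_leqP => i _.
    by rewrite (leq_trans (size_scale_leq _ _)) ?(hu i j).2.
  - apply: sos_convexD; last exact: sos_convexC.
    apply: sos_convexD => //.
    apply: (big_ind (@sos_convex R n)); first by rewrite -mpolyC0; exact: sos_convexC.
      exact: sos_convexD.
    by move=> i _; apply: sos_convexZ => //; case: (hp i).
  - rewrite /mdeg_le (leq_trans (msizeD_le _ _)) // geq_max.
    apply/andP; split; last by rewrite msizeC; case: eqP.
    rewrite (leq_trans (msizeD_le _ _)) // geq_max dp0 /=.
    apply: msize_sum_leq => i _.
    by rewrite (leq_trans (msizeZ_le _ _)) // (hp i).2.
  by exists lam, sigma, sig; split=> //; rewrite LE E.
have fd : mdeg_le f (2 * d0 d).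
  by apply: (msize_sep_poly_add (r := r)) => // [j|]; [case: (hu0 j) | exact: ltnW].
have gd i : mdeg_le (g i) (2 * d0 d).
  apply: (msize_sep_poly_add (r := r)) => [j||].
  - by case: (hu i j).
  - by case: (hp i).
  - exact: ltnW.
exists v; split=> //.
- split=> [_ [x [Fx ->]]|e e0]; first exact: vle.
  by have [x [Fx xv]] := vapp e e0; exists f.@[x]; split=> //; exists x.
- split=> [mu muD|e e0]; last by exists v; split=> //; lra.
  apply/ler_addgt0Pr => e e0; have [x [Fx xv]] := vapp e e0.
  exact: le_trans (D_feasible_le_CP muD Fx) (ltW xv).
(* Moment values are at least [v] by weak duality; near-optimal points of (CP) give moment values
   close to [v]. *)
- split=> [z zD|e e0]; first exact: D_feasible_le_Dt vD zD.
  have [x [Fx xv]] := vapp e e0; exists f.@[x]; split=> //.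
  by apply: CP_feasible_Dt => //; exact: ltnW.
Qed.
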